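(* Fix an integer $q\geq 1$. For all integers $N\geq 2$ we have \[\sqrt{\frac{q(q+2) n}{12}}\,\frac{1}{(1+q)^n} \binom{n}{k}^{(q)}=\frac{1}{\sqrt{2 \pi}} e^{-x^2/2}+\sum_{\nu=1}^{\left[(N-2)/2\right]} \frac{q_{2\nu}(x)}{n^{\nu}} +o\left(\frac{1}{n^{(N-2)/2}}\right)\] as $n\rightarrow \infty$, uniformly with respect to all $k\in\mathbb{Z}$, where \[x=\frac{\sqrt{12}}{\sqrt{q(q+2) n}}\left(k-\frac{q}{2}n\right),\] and for positive integers $\nu$, \[q_{2\nu} (x) = \frac{1}{\sqrt{2 \pi}} \left(\frac{12}{q(q+2)}\right)^{\nu} e^{-x^2 / 2}\sum_{\substack{k_2, k_4, \ldots, k_{2\nu} \geq 0 \\ k_2 + 2 k_4 + \cdots + \nu k_{2\nu} = \nu}} H_{2(\nu + s)} (x) \left(\frac{6}{q(q+2)}\right)^s \prod_{m=1}^{\nu} \frac{1}{k_{2m}!} \left( \frac{\mathcal{B}_{2(m+1)} \left((q+1)^{2m+2}-1\right)}{(2m+2)!\, (m+1) } \right)^{k_{2m}},\] with $s=k_2+k_4+\cdots+k_{2\nu}$.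
   Context: For $n,q\in\mathbb{N}=\{1,2,\ldots\}$ the extended binomial coefficients $\binom{n}{k}^{(q)}$ are defined by $\sum_{k=0}^{\infty}\binom{n}{k}^{(q)} x^k = (1+x+x^2+\cdots+x^{q})^n$, and $\binom{n}{k}^{(q)}=0$ for integers $k<0$. $H_m(x)=(-1)^m e^{x^2/2}\frac{d^m}{dx^m}e^{-x^2/2}$ are the (probabilists') Hermite polynomials. $\mathcal{B}_j$ denote the Bernoulli numbers (so $\mathcal{B}_2=1/6$, $\mathcal{B}_4=-1/30$), e.g. defined by $\frac{z}{e^z-1}=\sum_{j\ge0}\mathcal{B}_j\frac{z^j}{j!}$. $[\cdot]$ denotes the integer part; an empty sum is zero. *)

(* Defs.v *)
From Stdlib Require Import Reals Lra Lia ZArith Arith List.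
From Coquelicot Require Import Coquelicot.
Import ListNotations.
Open Scope R_scope.

(* Extended binomial coefficient binom(n,k)^(q): coefficient of x^k in
   (1 + x + ... + x^q)^n, for k : Z (zero for k < 0).  Defined by the
   coefficient convolution of (1+x+...+x^q) * (1+x+...+x^q)^n. *)
Fixpoint ext_binom (q n : nat) (k : Z) : nat :=
  match n with
  | O => if Z.eqb k 0 then 1%nat else 0%nat
  | S n' => fold_right Nat.add 0%nat
              (map (fun j => ext_binom q n' (k - Z.of_nat j)%Z) (seq 0 (S q)))
  end.

Definition hermite (m : nat) (x : R) : R :=
  (-1) ^ m * exp (x ^ 2 / 2) * Derive_n (fun t => exp (- t ^ 2 / 2)) m x.

Definition sumR (l : list R) : R := fold_right Rplus 0 l.
Definition prodR (l : list R) : R := fold_right Rmult 1 l.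
Definition sumN (l : list nat) : nat := fold_right Nat.add 0%nat l.

(* Bernoulli numbers via the standard recurrence equivalent to
   z/(e^z-1) = sum B_j z^j/j! :  B_0 = 1,
   sum_{k=0}^{n} C(n+1,k) B_k = 0 for n >= 1.
   bern_list n = [B_0; ...; B_n]. *)
Fixpoint bern_list (n : nat) : list R :=
  match n with
  | O => [1]
  | S n' => let l := bern_list n' in
            l ++ [ - / INR (n + 1) *
                   sumR (map (fun k => Binomial.C (n + 1) k * nth k l 0) (seq 0 n)) ]
  end.

Definition bernoulli (n : nat) : R := nth n (bern_list n) 0.

Fixpoint tuples (len b : nat) : list (list nat) :=
  match len with
  | O => [[]]
  | S l => flat_map (fun a => map (cons a) (tuples l b)) (seq 0 (S b))
  end.

(* For l = [k_2; k_4; ...; k_{2nu}] : weight = k_2 + 2 k_4 + ... + nu k_{2nu}. *)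
Definition weight (l : list nat) : nat :=
  sumN (map (fun i => (S i * nth i l 0)%nat) (seq 0 (length l))).

(* Index set: (k_2,...,k_{2nu}) >= 0 with k_2 + 2k_4 + ... + nu k_{2nu} = nu
   (each k_{2m} <= nu necessarily). *)
Definition compositions (nu : nat) : list (list nat) :=
  filter (fun l => Nat.eqb (weight l) nu) (tuples nu nu).

Definition qcoef (q nu : nat) (x : R) : R :=
  let Q := INR q * (INR q + 2) in
  / sqrt (2 * PI) * (12 / Q) ^ nu * exp (- x ^ 2 / 2) *
  sumR (map (fun l =>
      let s := sumN l in
      hermite (2 * (nu + s)) x * (6 / Q) ^ s *
      prodR (map (fun m =>
         let kk := nth (m - 1) l 0%nat in
         / INR (fact kk) *
         (bernoulli (2 * (m + 1)) * ((INR q + 1) ^ (2 * m + 2) - 1)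
          / (INR (fact (2 * m + 2)) * INR (m + 1))) ^ kk)
        (seq 1 nu)))
    (compositions nu)).

Lemma bern_check : bernoulli 1 = - / 2 /\ bernoulli 2 = / 6.
Proof.
  unfold bernoulli; simpl. unfold sumR, Binomial.C; simpl. split; field.
Qed.
Lemma ext_binom_check : ext_binom 2 2 2%Z = 3%nat.
Proof. reflexivity. Qed.

(* Main.v *)
(** The probability [ext_binom q n k / (q+1)^n] is the [k]-th Fourier coefficient of
    [phi^n], where [phi t = sin ((q+1) t/2) / ((q+1) sin (t/2))] is the centred
    characteristic function of the uniform law on [{0,...,q}].  The recursion of the
    Bernoulli numbers gives the power series of [u cot u], hence
    [log phi t = sum_j (-1)^j B_2j ((q+1)^2j - 1) / (2j (2j)!) t^2j] near [0].
    After rescaling [t] by the standard deviation [sqrt (n q (q+2) / 12)],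
    [phi^n] is [e^(-t^2/2)] times a product of exponentials [exp (b_m t^(2m+2) / n^m)];
    truncating each of them and collecting powers of [1/n] yields the sum over
    compositions.  Fourier inversion of [e^(-t^2/2) t^(2j)] produces the Hermite
    polynomials.  The error is bounded pointwise by [C n^-(L+1) / (1 + t^2)] with
    [L = (N-2)/2], so it integrates to [O(n^-(L+1))], uniformly in [k]. *)

Require Import Defs.
From Stdlib Require Import Reals ZArith Arith List Lra Lia.
From Coquelicot Require Import Coquelicot.
Open Scope R_scope.

(** * Fourier inversion *)

(** Only real integrals appear: the symmetry [j -> q - j] kills every sine sum, so cosines replace
    complex exponentials. No logarithm is taken: the kernel and its exponential form are identified
    because both solve one linear differential equation, whose coefficient is a difference of
    cotangent series. The crude bound [|B_n| <= n!] suffices, since only a positive radius of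
    convergence is used. The good variables are [y = v n t^2], with [v] the variance of one summand,
    and [h = 1/n]: the corrections to [-y/2] in the exponent are [b_i y^(i+1) h^i = b_i y (y h)^i],
    and as [y h = v t^2] they are a small multiple of [y] near the origin and cannot defeat
    [e^(-y/2)]. Improper integrals are avoided: integrals over [[-i, i]] obey a bound independent of
    [i], and then [i] tends to infinity. The integer [k] enters the error only through [cos (t x)],
    bounded by 1. Since [L] is [(N-2)/2] rounded down, [L + 1] exceeds [(N-2)/2] by at least one
    half, which turns the big O into the required little o. *)

Lemma sumR_app (l1 l2 : list R) : sumR (l1 ++ l2) = sumR l1 + sumR l2.
Proof.
  unfold sumR; induction l1 as [|a l1 IH]; simpl; [ring|rewrite IH; ring].
Qed.

Lemma sumR_plus {A} (f g : A -> R) l :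
  sumR (map (fun a => f a + g a) l) = sumR (map f l) + sumR (map g l).
Proof.
  unfold sumR; induction l as [|a l IH]; simpl; [ring|rewrite IH; ring].
Qed.

Lemma sumR_scal {A} (c : R) (f : A -> R) l :
  sumR (map (fun a => c * f a) l) = c * sumR (map f l).
Proof.
  unfold sumR; induction l as [|a l IH]; simpl; [ring|rewrite IH; ring].
Qed.

Lemma sumR_abs {A} (f : A -> R) l :
  Rabs (sumR (map f l)) <= sumR (map (fun a => Rabs (f a)) l).
Proof.
  unfold sumR; induction l as [|a l IH]; simpl.
  - rewrite Rabs_R0; lra.
  - eapply Rle_trans; [apply Rabs_triang|lra].
Qed.

Lemma sumR_le {A} (f g : A -> R) l :
  (forall a, In a l -> f a <= g a) -> sumR (map f l) <= sumR (map g l).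
Proof.
  unfold sumR; induction l as [|a l IH]; simpl; intros H; [lra|].
  apply Rplus_le_compat; [|apply IH]; auto.
Qed.

Lemma sumR_rev (f : nat -> R) n :
  sumR (map f (seq 0 n)) = sumR (map (fun j => f (n - 1 - j)%nat) (seq 0 n)).
Proof.
  induction n as [|n IH]; [reflexivity|].
  transitivity (f n + sumR (map f (seq 0 n))).
  - rewrite seq_S, map_app, sumR_app; unfold sumR; simpl; ring.
  - rewrite IH; simpl seq; rewrite <- seq_shift; simpl map; rewrite map_map.
    unfold sumR; simpl fold_right. f_equal; [f_equal; lia|].
    f_equal. apply map_ext. intros j; f_equal; lia.
Qed.

Lemma continuous_sumR {A} (f : A -> R -> R) l t :
  (forall a, continuous (f a) t) ->
  continuous (fun t => sumR (map (fun a => f a t) l)) t.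
Proof.
  intros H; unfold sumR; induction l as [|a l IH]; simpl.
  - apply continuous_const.
  - apply (continuous_plus (f a)); auto.
Qed.

Lemma ex_RInt_cont (f : R -> R) a b :
  (forall t, continuous f t) -> ex_RInt f a b.
Proof. intros H; apply (ex_RInt_continuous (V := R_CompleteNormedModule)); auto. Qed.

Lemma RInt_sumR {A} (f : A -> R -> R) l a b :
  (forall i t, continuous (f i) t) ->
  RInt (fun t => sumR (map (fun i => f i t) l)) a b =
  sumR (map (fun i => RInt (f i) a b) l).
Proof.
  intros H; induction l as [|i l IH].
  - unfold sumR; simpl.
    rewrite RInt_const; unfold scal; simpl; unfold mult; simpl; ring.
  - transitivity (RInt (f i) a b + RInt (fun t => sumR (map (fun i => f i t) l)) a b);
      [|rewrite IH; reflexivity].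
    apply (RInt_plus (f i)).
    + apply ex_RInt_cont; auto.
    + apply ex_RInt_cont; intros t; apply (continuous_sumR f l t); auto.
Qed.

(** * The centred Dirichlet kernel *)

Definition dirichlet (q : nat) (t : R) : R :=
  sumR (map (fun j => cos ((INR j - INR q / 2) * t)) (seq 0 (S q))).

(** Reflection [j -> q - j] reverses the sign of every term. Hence the cosine sum [dirichlet] is
    already the whole centred exponential sum. *)
Lemma dirichlet_sin0 (q : nat) (t : R) :
  sumR (map (fun j => sin ((INR j - INR q / 2) * t)) (seq 0 (S q))) = 0.
Proof.
  set (F := fun j => sin ((INR j - INR q / 2) * t)).
  assert (E : sumR (map F (seq 0 (S q))) = - sumR (map F (seq 0 (S q)))).
  { rewrite sumR_rev at 1.
    replace (- sumR (map F (seq 0 (S q)))) with (-1 * sumR (map F (seq 0 (S q)))) by ring.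
    rewrite <- sumR_scal. f_equal. apply map_ext_in; intros j Hj.
    apply in_seq in Hj. unfold F. replace (S q - 1 - j)%nat with (q - j)%nat by lia.
    rewrite minus_INR by lia.
    replace ((INR q - INR j - INR q / 2) * t) with (- ((INR j - INR q / 2) * t)) by field.
    rewrite sin_neg; ring. }
  lra.
Qed.

(** Adding the vanishing sine sum times [sin (y t)] turns the product into a sum of cosines of
    differences; this frequency shift matches one step of the convolution. *)
Lemma dirichlet_cos (q : nat) (y t : R) :
  dirichlet q t * cos (y * t) =
  sumR (map (fun j => cos ((y - INR j + INR q / 2) * t)) (seq 0 (S q))).
Proof.
  rewrite <- (Rplus_0_r (_ * _)), <- (Rmult_0_l (sin (y * t))), <- (dirichlet_sin0 q t).
  unfold dirichlet.
  rewrite (Rmult_comm _ (cos _)), (Rmult_comm _ (sin _)), <- !sumR_scal, <- sumR_plus.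
  f_equal; apply map_ext; intros j.
  replace ((y - INR j + INR q / 2) * t) with (y * t - (INR j - INR q / 2) * t) by ring.
  rewrite cos_minus; ring.
Qed.

(** Passing from [q] to [q + 1] recentres the old frequencies by [-1/2], again through the vanishing
    sine sum; the new top frequency is [(q + 1)/2]. *)
Lemma dirichlet_S (q : nat) (t : R) :
  dirichlet (S q) t = dirichlet q t * cos (t / 2) + cos (INR (S q) * t / 2).
Proof.
  unfold dirichlet at 1. rewrite seq_S, map_app, sumR_app.
  f_equal.
  - rewrite <- (Rplus_0_r (_ * _)), <- (Rmult_0_l (sin (t / 2))), <- (dirichlet_sin0 q t).
    unfold dirichlet.
    rewrite (Rmult_comm _ (cos _)), (Rmult_comm _ (sin _)), <- !sumR_scal, <- sumR_plus.
    f_equal; apply map_ext; intros j.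
    replace ((INR j - INR (S q) / 2) * t) with ((INR j - INR q / 2) * t - t / 2)
      by (rewrite S_INR; field).
    rewrite cos_minus; ring.
  - transitivity (cos ((INR (S q) - INR (S q) / 2) * t)); [apply Rplus_0_r|].
    f_equal. field.
Qed.

Lemma dirichlet_0 t : dirichlet 0 t = 1.
Proof.
  unfold dirichlet, sumR; simpl. replace ((0 - 0 / 2) * t) with 0 by field.
  rewrite cos_0; ring.
Qed.

(** The closed form of the kernel, kept as a product so that [t = 0] is no exception. *)
Lemma dirichlet_sin (q : nat) (t : R) :
  dirichlet q t * sin (t / 2) = sin (INR (S q) * t / 2).
Proof.
  induction q as [|q IH].
  - rewrite dirichlet_0. simpl INR. replace (1 * t / 2) with (t / 2) by field. ring.
  - rewrite dirichlet_S, Rmult_plus_distr_r.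
    replace (INR (S (S q)) * t / 2) with (INR (S q) * t / 2 + t / 2)
      by (rewrite (S_INR (S q)); field).
    rewrite sin_plus, <- IH; ring.
Qed.

(** The recursion is unrolled with [|cos| <= 1], except for its last factor [cos (t/2)], which alone
    provides the decay. *)
Lemma dirichlet_bound (q : nat) (t : R) :
  (1 <= q)%nat -> Rabs (dirichlet q t) <= INR q * Rabs (cos (t / 2)) + 1.
Proof.
  assert (C1 : forall z, Rabs (cos z) <= 1)
    by (intros z; apply Rabs_le; destruct (COS_bound z); lra).
  intros Hq; induction q as [|q IH]; [lia|]. clear Hq.
  rewrite dirichlet_S, S_INR.
  eapply Rle_trans; [apply Rabs_triang|].
  rewrite Rabs_mult.
  apply Rplus_le_compat; [|apply C1].
  apply Rmult_le_compat_r; [apply Rabs_pos|].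
  destruct q as [|q]; [rewrite dirichlet_0, Rabs_R1; simpl; lra|].
  eapply Rle_trans; [apply IH; lia|].
  apply Rplus_le_compat_r. rewrite <- (Rmult_1_r (INR (S q))) at 2.
  apply Rmult_le_compat_l; [apply pos_INR|apply C1].
Qed.

Lemma continuous_dirichlet q t : continuous (dirichlet q) t.
Proof.
  apply (continuous_sumR (fun j t => cos ((INR j - INR q / 2) * t))).
  intros j. apply (ex_derive_continuous (V := R_NormedModule)). auto_derive; auto.
Qed.

Lemma continuous_pow_fun (f : R -> R) n t :
  continuous f t -> continuous (fun t => f t ^ n) t.
Proof.
  intros H; induction n as [|n IH]; simpl.
  - apply continuous_const.
  - apply (continuous_mult f); auto.
Qed.

Lemma continuous_dirichlet_pow_cos q n y t :
  continuous (fun t => dirichlet q t ^ n * cos (y * t)) t.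
Proof.
  apply (continuous_mult (fun t => dirichlet q t ^ n)).
  - apply continuous_pow_fun, continuous_dirichlet.
  - apply (ex_derive_continuous (V := R_NormedModule)). auto_derive; auto.
Qed.

Lemma RInt_cos_int (k : Z) :
  RInt (fun t => cos (IZR k * t)) (- PI) PI = if Z.eqb k 0 then 2 * PI else 0.
Proof.
  destruct (Z.eqb_spec k 0) as [->|Hk].
  - rewrite (RInt_ext _ (fun _ => 1)).
    + rewrite RInt_const; unfold scal; simpl; unfold mult; simpl; ring.
    + intros x _. rewrite Rmult_0_l; apply cos_0.
  - assert (IZR k <> 0) by (apply not_0_IZR; auto).
    apply is_RInt_unique.
    replace 0 with (minus (sin (IZR k * PI) / IZR k) (sin (IZR k * - PI) / IZR k)).
    + apply (is_RInt_derive (fun t => sin (IZR k * t) / IZR k)).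
      * intros t _. auto_derive; auto. field; auto.
      * intros t _. apply (ex_derive_continuous (V := R_NormedModule)). auto_derive; auto.
    + unfold minus, plus, opp; simpl.
      replace (IZR k * - PI) with (- (IZR k * PI)) by ring.
      rewrite sin_neg, (sin_eq_0_1 (IZR k * PI)); [field; auto|exists k; auto].
Qed.

Lemma INR_sumN (f : nat -> nat) l :
  INR (fold_right Nat.add 0%nat (map f l)) = sumR (map (fun j => INR (f j)) l).
Proof.
  unfold sumR; induction l as [|a l IH]; simpl fold_right; [reflexivity|].
  simpl map; simpl fold_right. rewrite plus_INR, IH; reflexivity.
Qed.

(** Induction on [n] for all [k]: one more kernel shifts the frequency by [q/2 - j], exactly as the
    convolution shifts [k]. The base case is orthogonality of cosines of integer frequency. *)
Lemma ext_binom_fourier (q n : nat) (k : Z) :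
  2 * PI * INR (ext_binom q n k) =
  RInt (fun t => dirichlet q t ^ n * cos ((IZR k - INR q / 2 * INR n) * t)) (- PI) PI.
Proof.
  revert k; induction n as [|n IH]; intros k.
  - rewrite (RInt_ext _ (fun t => cos (IZR k * t))).
    + rewrite RInt_cos_int. simpl. destruct (Z.eqb k 0); simpl; ring.
    + intros t _. simpl. rewrite Rmult_0_r, Rminus_0_r; ring.
  - change (ext_binom q (S n) k) with
      (fold_right Nat.add 0%nat (map (fun j => ext_binom q n (k - Z.of_nat j)) (seq 0 (S q)))).
    rewrite INR_sumN, <- sumR_scal.
    rewrite (map_ext _ _ (fun j => IH (k - Z.of_nat j)%Z)).
    rewrite <- (RInt_sumR (fun j t => dirichlet q t ^ n *
        cos ((IZR (k - Z.of_nat j) - INR q / 2 * INR n) * t)))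
      by (intros; apply continuous_dirichlet_pow_cos).
    apply RInt_ext; intros t _.
    rewrite sumR_scal, <- tech_pow_Rmult.
    rewrite (Rmult_comm (dirichlet q t)), Rmult_assoc, dirichlet_cos.
    f_equal. f_equal. apply map_ext; intros j. f_equal.
    rewrite minus_IZR, <- INR_IZR_INZ, (S_INR n). field.
Qed.

Lemma cos_upper u : Rabs u <= PI / 2 -> 0 <= cos u <= 1 - u ^ 2 / 3.
Proof.
  intros Hu. apply Rabs_le_between in Hu as [H1 H2].
  split; [apply cos_ge_0; lra|].
  destruct (cos_bound u 0) as [_ H]; try lra.
  eapply Rle_trans; [apply H|].
  (* The Taylor bound is [1 - u^2/2 + u^4/24], and [u^2 <= 4] because [pi <= 4]. *)
  unfold cos_approx, cos_term; simpl.
  assert (P := PI_4). assert (u * u <= 4) by nra.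
  assert (0 <= u * u) by nra.
  assert (u * u * (u * u) <= 4 * (u * u)) by nra.
  apply Rminus_le. field_simplify. nra.
Qed.

(** With [cos (t/2) <= 1 - t^2/12], the bound [(q cos (t/2) + 1)/(q + 1)] is at most [1 - t^2/24],
    because [q/(q + 1) >= 1/2]. *)
Lemma dirichlet_decay (q : nat) (t : R) :
  (1 <= q)%nat -> Rabs t <= PI ->
  Rabs (dirichlet q t / (1 + INR q)) <= exp (- (t ^ 2 / 24)).
Proof.
  intros Hq Ht. assert (1 <= INR q) by (apply (le_INR 1); auto).
  destruct (cos_upper (t / 2)) as [C0 C1].
  { unfold Rdiv; rewrite Rabs_mult, (Rabs_right (/ 2)) by lra. lra. }
  apply Rle_trans with (1 + - (t ^ 2 / 24)); [|apply exp_ineq1_le].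
  unfold Rdiv at 1. rewrite Rabs_mult, Rabs_inv, (Rabs_right (1 + INR q)) by lra.
  apply (Rmult_le_reg_r (1 + INR q)); [lra|].
  rewrite Rmult_assoc, Rinv_l, Rmult_1_r by lra.
  eapply Rle_trans; [apply dirichlet_bound; auto|].
  rewrite (Rabs_right (cos _)) by lra.
  replace ((t / 2) ^ 2) with (t ^ 2 / 4) in C1 by field.
  assert (0 <= t ^ 2) by apply pow2_ge_0. nra.
Qed.

(** * Bernoulli numbers and the cotangent series *)

Lemma sumR_sum_f_R0 (f : nat -> R) n : sumR (map f (seq 0 (S n))) = sum_f_R0 f n.
Proof.
  induction n as [|n IH]; [unfold sumR; simpl; ring|].
  rewrite seq_S, map_app, sumR_app, IH. unfold sumR; simpl; ring.
Qed.

Lemma bern_list_length n : length (bern_list n) = S n.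
Proof.
  induction n as [|n IH]; [reflexivity|].
  simpl bern_list. rewrite length_app, IH; simpl; lia.
Qed.

Lemma bern_list_nth n k : (k <= n)%nat -> nth k (bern_list n) 0 = bernoulli k.
Proof.
  induction n as [|n IH]; intros H.
  - replace k with 0%nat by lia; reflexivity.
  - destruct (Nat.eq_dec k (S n)) as [->|Hk]; [reflexivity|].
    rewrite <- IH by lia. simpl bern_list. apply app_nth1.
    rewrite bern_list_length; lia.
Qed.

Lemma bernoulli_S n :
  bernoulli (S n) = - / INR (S n + 1) *
    sum_f_R0 (fun k => Binomial.C (S n + 1) k * bernoulli k) n.
Proof.
  unfold bernoulli at 1.
  change (bern_list (S n)) with (bern_list n ++ (- / INR (S n + 1) *
    sumR (map (fun k => Binomial.C (S n + 1) k * nth k (bern_list n) 0) (seq 0 (S n))))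
    :: nil).
  rewrite app_nth2; rewrite bern_list_length; [|lia].
  rewrite Nat.sub_diag. cbn [nth]. f_equal.
  rewrite <- sumR_sum_f_R0. apply (f_equal sumR). apply map_ext_in; intros k Hk.
  apply in_seq in Hk. rewrite bern_list_nth by lia. reflexivity.
Qed.

(** The coefficients of [z/(e^z - 1)]; [expm1_coef] below holds those of [(e^z - 1)/z]. *)
Definition beta (n : nat) : R := bernoulli n / INR (fact n).

Definition expm1_coef (n : nat) : R := / INR (fact (S n)).

(** The Bernoulli recurrence divided by [(n+2)!]: coefficient [n + 1] of the Cauchy product with
    [(e^z - 1)/z] vanishes. *)
Lemma beta_S n : beta (S n) = - sum_f_R0 (fun k => beta k * expm1_coef (S n - k)) n.
Proof.
  unfold beta at 1. rewrite bernoulli_S.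
  unfold Rdiv. rewrite <- 2!Ropp_mult_distr_l. f_equal.
  rewrite Rmult_assoc, (Rmult_comm (sum_f_R0 _ _)), <- Rmult_assoc, scal_sum. apply sum_eq; intros k Hk.
  unfold beta, expm1_coef, Binomial.C.
  replace (S n + 1 - k)%nat with (S (S n - k)) by lia.
  replace (S n + 1)%nat with (S (S n)) by lia.
  rewrite (fact_simpl (S n)), mult_INR. field.
  repeat split; try apply INR_fact_neq_0. apply not_0_INR; lia.
Qed.

Lemma PS_mult_beta n : PS_mult beta expm1_coef n = if n then 1 else 0.
Proof.
  destruct n as [|n]; unfold PS_mult.
  - unfold beta, bernoulli, expm1_coef; simpl; field.
  - rewrite tech5, beta_S, Nat.sub_diag.
    replace (expm1_coef 0) with 1 by (unfold expm1_coef; simpl; field).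
    ring.
Qed.

Lemma geom_half n : sum_f_R0 (fun k => / 2 ^ (S n - k)) n = 1 - / 2 ^ S n.
Proof.
  induction n as [|n IH]; [simpl; field|].
  rewrite tech5, (sum_eq _ (fun k => / 2 ^ (S n - k) * / 2)).
  - rewrite <- scal_sum, IH. replace (S (S n) - S n)%nat with 1%nat by lia.
    simpl; field. apply pow_nonzero; lra.
  - intros k Hk. replace (S (S n) - k)%nat with (S (S n - k)) by lia.
    rewrite <- tech_pow_Rmult, Rinv_mult; ring.
Qed.

Lemma fact_ge_pow2 n : 2 ^ n <= INR (fact (S n)).
Proof.
  induction n as [|n IH]; [simpl; lra|].
  rewrite fact_simpl, mult_INR. simpl pow.
  apply Rmult_le_compat; try lra; [apply pow_le; lra|].
  apply (le_INR 2); lia.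
Qed.

Lemma expm1_coef_bound n : Rabs (expm1_coef n) <= / 2 ^ n.
Proof.
  unfold expm1_coef. rewrite Rabs_right.
  - apply Rinv_le_contravar; [apply pow_lt; lra|apply fact_ge_pow2].
  - apply Rle_ge, Rlt_le, Rinv_0_lt_compat, INR_fact_lt_0.
Qed.

(** Strong induction: [(k+1)! >= 2^k] bounds the recursion by [1/2 + 1/4 + ... < 1]. *)
Lemma beta_bound n : Rabs (beta n) <= 1.
Proof.
  induction n as [n IH] using (well_founded_induction lt_wf).
  destruct n as [|n].
  - unfold beta, bernoulli; simpl. unfold Rdiv; rewrite Rmult_1_l, Rinv_1, Rabs_R1; lra.
  - rewrite beta_S, Rabs_Ropp.
    eapply Rle_trans; [apply Rsum_abs|].
    apply Rle_trans with (1 - / 2 ^ S n).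
    + rewrite <- geom_half. apply sum_Rle; intros k Hk.
      rewrite Rabs_mult, <- (Rmult_1_l (/ _)).
      apply Rmult_le_compat; try apply Rabs_pos; [apply IH; lia|apply expm1_coef_bound].
    + assert (0 < / 2 ^ S n) by (apply Rinv_0_lt_compat, pow_lt; lra). lra.
Qed.

(** * Power series: radius of convergence and uniqueness of coefficients *)

Lemma CV_radius_ge (a : nat -> R) (r M : R) :
  (forall n, Rabs (a n * r ^ n) <= M) -> Rbar_le r (CV_radius a).
Proof.
  intros H. apply (proj1 (CV_radius_bounded a)). exists M; exact H.
Qed.

Lemma CV_radius_gt (a : nat -> R) (r M x : R) :
  (forall n, Rabs (a n * r ^ n) <= M) -> Rabs x < r -> Rbar_lt (Rabs x) (CV_radius a).
Proof.
  intros H Hx. apply Rbar_lt_le_trans with r; [exact Hx|].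
  apply CV_radius_ge with M; auto.
Qed.

Lemma bounded_unit (a : nat -> R) :
  (forall n, Rabs (a n) <= 1) -> forall n, Rabs (a n * 1 ^ n) <= 1.
Proof. intros H n. rewrite pow1, Rmult_1_r; auto. Qed.

Lemma CV_radius_pos (a : nat -> R) (x : R) :
  0 < Rabs x -> ex_pseries a x -> Rbar_lt 0 (CV_radius a).
Proof.
  intros Hx H. destruct (Rbar_lt_le_dec 0 (CV_radius a)) as [|Hle]; [assumption|].
  exfalso. apply (CV_disk_outside a x).
  - apply Rbar_le_lt_trans with 0; auto.
  - apply ex_series_lim_0. apply ex_pseries_R; exact H.
Qed.

Lemma PSeries_unique (a b : nat -> R) (r : R) :
  0 < r -> Rbar_lt 0 (CV_radius a) -> Rbar_lt 0 (CV_radius b) ->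
  (forall x, Rabs x < r -> PSeries a x = PSeries b x) -> forall n, a n = b n.
Proof.
  intros Hr Ha Hb H n.
  assert (E : Derive_n (PSeries a) n 0 = Derive_n (PSeries b) n 0).
  { apply Derive_n_ext_loc. exists (mkposreal r Hr). intros y Hy. apply H.
    revert Hy. unfold ball; simpl; unfold AbsRing_ball, abs, minus, plus, opp; simpl.
    rewrite Ropp_0, Rplus_0_r; auto. }
  rewrite !Derive_n_coef in E by assumption.
  apply Rmult_eq_reg_r with (2 := INR_fact_neq_0 n); exact E.
Qed.

(** Coefficients of [2z/(e^(2z) - 1)]; the next two sequences belong to [sinh z / z] and
    [e^(-z)]. *)
Definition beta2 (n : nat) : R := 2 ^ n * beta n.
Definition sinhc_coef (n : nat) : R := if Nat.even n then expm1_coef n else 0.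
Definition expN_coef (n : nat) : R := (-1) ^ n / INR (fact n).

Lemma expm1_coef_le1 n : Rabs (expm1_coef n) <= 1.
Proof.
  eapply Rle_trans; [apply expm1_coef_bound|].
  rewrite <- Rinv_1. apply Rinv_le_contravar; [lra|]. apply pow_R1_Rle; lra.
Qed.

Lemma inv_fact_le1 n : Rabs (/ INR (fact n)) <= 1.
Proof.
  rewrite Rabs_right by (apply Rle_ge, Rlt_le, Rinv_0_lt_compat, INR_fact_lt_0).
  rewrite <- Rinv_1. apply Rinv_le_contravar; [lra|].
  apply (le_INR 1). apply lt_O_fact.
Qed.

Lemma pow_m1_abs n : Rabs ((-1) ^ n) = 1.
Proof. rewrite <- RPow_abs, Rabs_m1, pow1; reflexivity. Qed.

Lemma ex_pseries_unit (a : nat -> R) (x : R) :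
  (forall n, Rabs (a n) <= 1) -> Rabs x < 1 -> ex_pseries a x.
Proof.
  intros H Hx. apply CV_radius_inside.
  apply CV_radius_gt with 1 1; auto. apply bounded_unit; auto.
Qed.

Lemma PSeries_expm1 z : Rabs z < 1 -> z * PSeries expm1_coef z = exp z - 1.
Proof.
  intros Hz. rewrite exp_Reals, (PSeries_decr_1 (fun n => / INR (fact n))).
  - simpl fact at 1. simpl INR at 1. rewrite Rinv_1.
    unfold PS_decr_1, expm1_coef. ring.
  - apply ex_pseries_unit; auto. intros; apply inv_fact_le1.
Qed.

Lemma PSeries_sinhc z :
  Rabs z < 1 -> PSeries sinhc_coef z = / 2 * (PSeries expm1_coef z + PSeries expm1_coef (- z)).
Proof.
  intros Hz. unfold PSeries at 2 3.
  rewrite <- Series_plus, <- Series_scal_l.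
  - apply Series_ext; intros n. unfold sinhc_coef.
    replace (- z) with (-1 * z) by ring. rewrite Rpow_mult_distr.
    destruct (Nat.even n) eqn:En.
    + apply Nat.even_spec in En as [m ->]. rewrite pow_1_even; field.
    + assert (Hodd : Nat.odd n = true) by (rewrite <- Nat.negb_even, En; auto).
      apply Nat.odd_spec in Hodd as [m ->].
      replace (2 * m + 1)%nat with (S (2 * m)) by lia. rewrite pow_1_odd; field.
  - apply ex_pseries_R, ex_pseries_unit; auto. apply expm1_coef_le1.
  - apply ex_pseries_R, ex_pseries_unit; [apply expm1_coef_le1|rewrite Rabs_Ropp; auto].
Qed.

Lemma PSeries_expN z : PSeries expN_coef z = exp (- z).
Proof.
  rewrite exp_Reals. apply Series_ext; intros n. unfold expN_coef.
  replace (- z) with (-1 * z) by ring. rewrite Rpow_mult_distr. field. apply INR_fact_neq_0.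
Qed.

Lemma PSeries_beta z : Rabs z < 1 -> PSeries beta z * PSeries expm1_coef z = 1.
Proof.
  intros Hz. rewrite <- PSeries_mult.
  - rewrite (PSeries_ext _ (fun n => if n then 1 else 0)) by apply PS_mult_beta.
    rewrite PSeries_decr_1.
    + rewrite (PSeries_ext _ (fun _ => 0)) by reflexivity.
      rewrite PSeries_const_0; ring.
    + apply ex_pseries_unit; auto. intros [|n]; [rewrite Rabs_R1|rewrite Rabs_R0]; lra.
  - apply CV_radius_gt with 1 1; auto. apply bounded_unit, beta_bound.
  - apply CV_radius_gt with 1 1; auto. apply bounded_unit, expm1_coef_le1.
Qed.

Lemma beta2_bound n : Rabs (beta2 n * (/ 2) ^ n) <= 1.
Proof.
  unfold beta2. replace (2 ^ n * beta n * (/ 2) ^ n) with (beta n * (2 * / 2) ^ n)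
    by (rewrite Rpow_mult_distr; ring).
  rewrite Rinv_r, pow1, Rmult_1_r by lra. apply beta_bound.
Qed.

Lemma sinhc_coef_le1 n : Rabs (sinhc_coef n) <= 1.
Proof.
  unfold sinhc_coef; destruct (Nat.even n); [apply expm1_coef_le1|rewrite Rabs_R0; lra].
Qed.

(* [2z/(e^(2z)-1) * sinh z / z = e^(-z)]: comparing even coefficients gives the
   recursion of [u cot u] without knowing that odd Bernoulli numbers vanish. *)
Lemma PSeries_beta2_sinhc z :
  Rabs z < / 2 -> PSeries beta2 z * PSeries sinhc_coef z = exp (- z).
Proof.
  intros Hz. assert (Hz1 : Rabs z < 1) by lra.
  destruct (Req_dec z 0) as [->|Nz].
  - rewrite !PSeries_0, Ropp_0, exp_0. unfold beta2, beta, bernoulli, sinhc_coef, expm1_coef.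
    simpl; field.
  - rewrite PSeries_sinhc by assumption.
    assert (E2 : PSeries beta2 z = PSeries beta (2 * z)).
    { apply Series_ext; intros n. unfold beta2. rewrite Rpow_mult_distr; ring. }
    rewrite E2.
    assert (H2 : Rabs (2 * z) < 1) by (rewrite Rabs_mult, (Rabs_right 2) by lra; lra).
    assert (A := PSeries_beta _ H2). assert (B := PSeries_expm1 _ H2).
    assert (C := PSeries_expm1 _ Hz1).
    assert (D : - z * PSeries expm1_coef (- z) = exp (- z) - 1)
      by (apply PSeries_expm1; rewrite Rabs_Ropp; auto).
    set (e1 := PSeries expm1_coef z) in *. set (e2 := PSeries expm1_coef (- z)) in *.
    set (e3 := PSeries expm1_coef (2 * z)) in *. set (b := PSeries beta (2 * z)) in *.
    assert (X : exp (2 * z) = exp z * exp z) by (rewrite <- exp_plus; f_equal; ring).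
    assert (Y : exp z * exp (- z) = 1) by (rewrite <- exp_plus, Rplus_opp_r; apply exp_0).
    (* This is [sinh z / z = e^(-z) (e^(2z) - 1)/(2z)], checked after clearing [2z]. *)
    assert (W : / 2 * (e1 + e2) = exp (- z) * e3).
    { apply Rmult_eq_reg_l with (2 * z); [|lra].
      replace (2 * z * (/ 2 * (e1 + e2))) with (z * e1 - (- z * e2)) by field.
      replace (2 * z * (exp (- z) * e3)) with (exp (- z) * (2 * z * e3)) by ring.
      rewrite B, C, D, X. replace (exp (- z) * (exp z * exp z - 1))
        with (exp z * exp (- z) * exp z - exp (- z)) by ring. rewrite Y; ring. }
    rewrite W. replace (b * (exp (- z) * e3)) with (b * e3 * exp (- z)) by ring.
    rewrite A; ring.
Qed.

Lemma sum_even (f : nat -> R) m :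
  (forall j, f (S (2 * j)) = 0) -> sum_f_R0 f (2 * m) = sum_f_R0 (fun j => f (2 * j)%nat) m.
Proof.
  intros H. induction m as [|m IH]; [reflexivity|].
  replace (2 * S m)%nat with (S (S (2 * m))) by lia.
  rewrite !tech5, IH, H. replace (S (S (2 * m))) with (2 * S m)%nat by lia. ring.
Qed.

Lemma beta_even_recursion m :
  sum_f_R0 (fun j => 4 ^ j * beta (2 * j) / INR (fact (2 * (m - j) + 1))) m
  = / INR (fact (2 * m)).
Proof.
  assert (R1 : forall x, Rabs x < / 2 -> Rbar_lt (Rabs x) (CV_radius beta2))
    by (intros; apply CV_radius_gt with (/ 2) 1; auto using beta2_bound).
  assert (R2 : forall x, Rabs x < / 2 -> Rbar_lt (Rabs x) (CV_radius sinhc_coef)).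
  { intros; apply CV_radius_gt with 1 1; [|lra].
    apply bounded_unit, sinhc_coef_le1. }
  assert (Q : Rabs (/ 4) < / 2) by (rewrite Rabs_right; lra).
  assert (U : PS_mult beta2 sinhc_coef (2 * m) = expN_coef (2 * m)).
  { apply PSeries_unique with (/ 2); [lra| | |].
    - apply CV_radius_pos with (/ 4); [rewrite Rabs_right; lra|].
      apply ex_pseries_mult; auto.
    - apply CV_radius_pos with (/ 4); [rewrite Rabs_right; lra|].
      apply ex_pseries_unit; [|lra]. intros n; unfold expN_coef, Rdiv.
      rewrite Rabs_mult, pow_m1_abs, Rmult_1_l. apply inv_fact_le1.
    - intros x Hx. rewrite PSeries_mult, PSeries_expN by auto.
      apply PSeries_beta2_sinhc; auto. }
  unfold PS_mult, expN_coef in U. rewrite pow_1_even in U.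
  unfold Rdiv in U at 1; rewrite Rmult_1_l in U. rewrite <- U.
  (* As [2m - k] has the parity of [k], only even-indexed Bernoulli numbers survive in the Cauchy
     product. *)
  assert (Ev : forall k, (k <= 2 * m)%nat -> Nat.even (2 * m - k) = Nat.even k).
  { intros k Hk. rewrite Nat.even_sub, Nat.even_mul by assumption. simpl.
    destruct (Nat.even k); reflexivity. }
  rewrite (sum_eq (fun k => beta2 k * sinhc_coef (2 * m - k))
      (fun k => beta2 k * if Nat.even k then expm1_coef (2 * m - k) else 0))
    by (intros k Hk; unfold sinhc_coef; rewrite Ev by assumption; reflexivity).
  rewrite sum_even.
  - apply sum_eq; intros j Hj. rewrite Nat.even_mul; simpl orb.
    unfold beta2, expm1_coef. rewrite pow_mult. replace (2 ^ 2) with 4 by ring.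
    replace (S (2 * m - 2 * j)) with (2 * (m - j) + 1)%nat by lia. cbv iota. reflexivity.
  - intros j. rewrite Nat.even_succ, Nat.odd_mul; simpl andb. cbv iota. ring.
Qed.

(** Coefficients of [u cot u] in powers of [u^2]: the even part [z coth z] of [2z/(e^(2z) - 1)],
    taken at [z = i u]. *)
Definition cot_coef (j : nat) : R := (-1) ^ j * 4 ^ j * beta (2 * j).

Lemma cot_coef_bound j : Rabs (cot_coef j * (/ 4) ^ j) <= 1.
Proof.
  unfold cot_coef.
  replace ((-1) ^ j * 4 ^ j * beta (2 * j) * (/ 4) ^ j)
    with ((-1) ^ j * (4 * / 4) ^ j * beta (2 * j)) by (rewrite Rpow_mult_distr; ring).
  rewrite Rinv_r, pow1, Rmult_1_r, Rabs_mult, pow_m1_abs, Rmult_1_l by lra.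
  apply beta_bound.
Qed.

(** The even recursion with the sign [(-1)^m] distributed over both factors; [sin_n] and [cos_n] are
    the coefficients of [sin u / u] and [cos u] in [u^2]. *)
Lemma PS_mult_cot m : PS_mult cot_coef sin_n m = cos_n m.
Proof.
  unfold PS_mult, cos_n, Rdiv. rewrite <- beta_even_recursion, scal_sum.
  apply sum_eq; intros j Hj. unfold cot_coef, sin_n, Rdiv.
  replace ((-1) ^ m) with ((-1) ^ j * (-1) ^ (m - j)) by (rewrite <- pow_add; f_equal; lia).
  ring.
Qed.

Lemma PSeries_sin u : sin u = u * PSeries sin_n (u ^ 2).
Proof.
  unfold sin. destruct (exist_sin (Rsqr u)) as [a Ha]. f_equal.
  symmetry. apply is_series_unique. apply is_series_Reals.
  rewrite <- Rsqr_pow2; exact Ha.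
Qed.

Lemma PSeries_cos u : cos u = PSeries cos_n (u ^ 2).
Proof.
  unfold cos. destruct (exist_cos (Rsqr u)) as [a Ha].
  symmetry. apply is_series_unique. apply is_series_Reals.
  rewrite <- Rsqr_pow2; exact Ha.
Qed.

Lemma cot_series u : Rabs u < / 2 -> PSeries cot_coef (u ^ 2) * sin u = u * cos u.
Proof.
  intros Hu. rewrite PSeries_sin, PSeries_cos.
  assert (Hw : Rabs (u ^ 2) < / 4).
  { rewrite <- RPow_abs. assert (0 <= Rabs u) by apply Rabs_pos. nra. }
  rewrite <- (PSeries_ext _ _ _ PS_mult_cot), PSeries_mult.
  - ring.
  - apply CV_radius_gt with (/ 4) 1; auto using cot_coef_bound.
  - apply CV_radius_gt with 1 1; [|lra]. apply bounded_unit; intros n.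
    unfold sin_n, Rdiv. rewrite Rabs_mult, pow_m1_abs, Rmult_1_l. apply inv_fact_le1.
Qed.

(** * The logarithm of the characteristic function *)

(* At [j = 0] the division by [0] is harmless, the numerator being [0]. *)
Definition kappa (q j : nat) : R :=
  (-1) ^ j * beta (2 * j) * ((INR q + 1) ^ (2 * j) - 1) / INR (2 * j).

Lemma kappa_0 q : kappa q 0 = 0.
Proof. unfold kappa; simpl. unfold Rdiv; ring. Qed.

(** This will be the logarithm of [dirichlet q t / (1 + q)] near 0. *)
Definition Kfun (q : nat) (t : R) : R := PSeries (kappa q) (t ^ 2).

(** From [|beta| <= 1] and [Q^(2j) - 1 <= Q^(2j)]; it yields a radius of at least [(q+1)^(-2)] in
    the variable [t^2]. *)
Lemma kappa_bound q j : Rabs (kappa q j * (/ (INR q + 1) ^ 2) ^ j) <= 1.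
Proof.
  assert (Hq := pos_INR q). set (Q := INR q + 1) in *. assert (1 <= Q) by (unfold Q; lra).
  destruct j as [|j]; [rewrite kappa_0, Rmult_0_l, Rabs_R0; lra|].
  assert (P1 : 1 <= Q ^ (2 * S j)) by (apply pow_R1_Rle; lra).
  unfold kappa, Rdiv. fold Q. rewrite pow_inv, <- pow_mult, !Rabs_mult, pow_m1_abs, Rmult_1_l.
  rewrite (Rabs_right (_ - 1)), !Rabs_inv, (Rabs_right (INR _)), (Rabs_right (Q ^ _)) by
    (try lra; apply Rle_ge, pos_INR).
  assert (N1 : 1 <= INR (2 * S j)) by (apply (le_INR 1); lia).
  assert (B := beta_bound (2 * S j)). assert (B0 := Rabs_pos (beta (2 * S j))).
  set (b := Rabs (beta (2 * S j))) in *. set (P := Q ^ (2 * S j)) in *.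
  set (N := INR (2 * S j)) in *.
  assert (/ N <= 1) by (rewrite <- Rinv_1; apply Rinv_le_contravar; lra).
  assert (0 < / N) by (apply Rinv_0_lt_compat; lra).
  assert (0 < / P) by (apply Rinv_0_lt_compat; lra).
  apply Rle_trans with (1 * P * 1 * / P).
  - apply Rmult_le_compat_r; [lra|].
    apply Rmult_le_compat; try lra; [apply Rmult_le_pos; lra|].
    apply Rmult_le_compat; lra.
  - right; field; lra.
Qed.

Lemma kappa_radius q x :
  Rabs x < / (INR q + 1) ^ 2 -> Rbar_lt (Rabs x) (CV_radius (kappa q)).
Proof. intros H; apply CV_radius_gt with (/ (INR q + 1) ^ 2) 1; auto using kappa_bound. Qed.

Lemma sqr_lt_radius q t :
  Rabs t < / (INR q + 1) -> Rabs (t ^ 2) < / (INR q + 1) ^ 2.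
Proof.
  intros H. rewrite <- RPow_abs, <- pow_inv. assert (0 <= Rabs t) by apply Rabs_pos. nra.
Qed.

(** With [w = t^2] the left side is [t] times the derivative of [Kfun], and the right side is [t]
    times the logarithmic derivative of [sin (Q t/2) / sin (t/2)]. Differentiation cancels the [2j]
    in [kappa], and [4^j ((Q^2/4)^j - (1/4)^j) = Q^(2j) - 1]. *)
Lemma PSeries_kappa_derive q w :
  Rabs w < / (INR q + 1) ^ 2 ->
  2 * w * PSeries (PS_derive (kappa q)) w =
  PSeries cot_coef ((INR q + 1) ^ 2 / 4 * w) - PSeries cot_coef (/ 4 * w).
Proof.
  intros Hw. assert (Hq := pos_INR q). set (Q := INR q + 1) in *.
  assert (1 <= Q) by (unfold Q; lra).
  assert (C : forall x, Rabs x < / 4 -> ex_series (fun n => cot_coef n * x ^ n)).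
  { intros x Hx. apply ex_pseries_R, CV_radius_inside, CV_radius_gt with (/ 4) 1;
      auto using cot_coef_bound. }
  assert (H1 : Rabs (Q ^ 2 / 4 * w) < / 4).
  { rewrite Rabs_mult, Rabs_right by nra.
    apply Rlt_le_trans with (Q ^ 2 / 4 * / Q ^ 2).
    - apply Rmult_lt_compat_l; [nra|auto].
    - right; field; lra. }
  assert (H2 : Rabs (/ 4 * w) < / 4).
  { rewrite Rabs_mult, Rabs_right by lra.
    assert (/ Q ^ 2 <= 1) by (rewrite <- Rinv_1; apply Rinv_le_contravar; nra). nra. }
  unfold PSeries at 2 3. rewrite <- Series_minus by auto.
  (* The constant terms of the two cotangent series cancel, so the index can be shifted to match
     [PS_derive]. *)
  rewrite Series_incr_1 by (apply (ex_series_minus (V := R_NormedModule)); auto).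
  rewrite 2!pow_O, !Rmult_1_r, Rminus_diag, Rplus_0_l.
  unfold PSeries. rewrite <- Series_scal_l. apply Series_ext; intros n.
  unfold PS_derive, kappa, cot_coef. fold Q.
  rewrite !Rpow_mult_distr. unfold Rdiv. rewrite Rpow_mult_distr, <- pow_mult.
  rewrite (pow_inv 4).
  rewrite mult_INR. simpl (INR 2). rewrite <- (tech_pow_Rmult w n).
  field. split; [apply pow_nonzero; lra|]. apply not_0_INR; lia.
Qed.

Lemma is_derive_Kfun q t :
  Rabs t < / (INR q + 1) ->
  is_derive (Kfun q) t (2 * t * PSeries (PS_derive (kappa q)) (t ^ 2)).
Proof.
  intros Ht. unfold Kfun.
  apply (is_derive_comp (PSeries (kappa q)) (fun t => t ^ 2)).
  - apply is_derive_PSeries, kappa_radius, sqr_lt_radius, Ht.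
  - auto_derive; auto; ring.
Qed.

Lemma ex_derive_sumR {A} (f : A -> R -> R) l t :
  (forall a, ex_derive (f a) t) -> ex_derive (fun t => sumR (map (fun a => f a t) l)) t.
Proof.
  intros H; induction l as [|a l IH]; unfold sumR; simpl.
  - apply ex_derive_const.
  - apply (ex_derive_plus (f a)); auto.
Qed.

Lemma dirichlet_neg q t : dirichlet q (- t) = dirichlet q t.
Proof.
  unfold dirichlet. apply (f_equal sumR), map_ext; intros j.
  rewrite <- cos_neg. f_equal; ring.
Qed.

Lemma Kfun_neg q t : Kfun q (- t) = Kfun q t.
Proof. unfold Kfun; f_equal; ring. Qed.

Lemma dirichlet_at_0 q : dirichlet q 0 = INR q + 1.
Proof.
  unfold dirichlet. rewrite (map_ext _ (fun _ => 1)).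
  - rewrite sumR_sum_f_R0, sum_cte, S_INR; ring.
  - intros j; rewrite Rmult_0_r; apply cos_0.
Qed.

(** Differentiating [dirichlet_sin] and inserting [cot_series] at [t/2] and [(q+1) t/2] shows that
    the kernel solves [D' = K' D]. *)
Lemma is_derive_dirichlet q t :
  t <> 0 -> Rabs t < / (INR q + 1) ->
  is_derive (dirichlet q) t
    (2 * t * PSeries (PS_derive (kappa q)) (t ^ 2) * dirichlet q t).
Proof.
  intros Nt Ht. assert (Hq := pos_INR q).
  assert (Ht1 : Rabs t < 1).
  { eapply Rlt_le_trans; [exact Ht|]. rewrite <- Rinv_1; apply Rinv_le_contravar; lra. }
  assert (Ex : ex_derive (dirichlet q) t).
  { apply (ex_derive_sumR (fun j t => cos ((INR j - INR q / 2) * t))).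
    intros j; auto_derive; auto. }
  assert (Sn : sin (t / 2) <> 0).
  { assert (P := PI_4). assert (P3 := PI2_1). apply Rabs_def2 in Ht1.
    destruct (Rtotal_order t 0) as [H|[H|H]]; [|lra|].
    - apply Rlt_not_eq, sin_lt_0_var; lra.
    - apply Rgt_not_eq, sin_gt_0; lra. }
  set (d := Derive (dirichlet q) t).
  assert (Hd : is_derive (dirichlet q) t d) by (apply Derive_correct; auto).
  assert (E : d * sin (t / 2) + dirichlet q t * (/ 2 * cos (t / 2))
            = INR (S q) / 2 * cos (INR (S q) * t / 2)).
  { transitivity (Derive (fun t => dirichlet q t * sin (t / 2)) t).
    - symmetry. apply is_derive_unique.
      apply (is_derive_mult (dirichlet q) (fun t => sin (t / 2)) t d (/ 2 * cos (t / 2))); auto.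
      + auto_derive; auto; unfold Rdiv; ring.
      + intros; apply Rmult_comm.
    - rewrite (Derive_ext _ (fun t => sin (INR (S q) * t / 2))) by (intros; apply dirichlet_sin).
      generalize (INR (S q)); intros N.
      apply is_derive_unique. auto_derive; auto. unfold Rdiv; ring. }
  set (p := PSeries (PS_derive (kappa q)) (t ^ 2)).
  replace (2 * t * p * dirichlet q t) with d; [exact Hd|].
  assert (F := PSeries_kappa_derive q (t ^ 2) (sqr_lt_radius q t Ht)). fold p in F.
  replace ((INR q + 1) ^ 2 / 4 * t ^ 2) with ((INR (S q) * t / 2) ^ 2) in F
    by (rewrite S_INR; field).
  replace (/ 4 * t ^ 2) with ((t / 2) ^ 2) in F by field.
  assert (C0 := cot_series (t / 2)). assert (C1 := cot_series (INR (S q) * t / 2)).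
  rewrite <- dirichlet_sin in C1.
  set (D := dirichlet q t) in *. set (s := sin (t / 2)) in *.
  set (c := cos (t / 2)) in *. set (c1 := cos (INR (S q) * t / 2)) in *.
  set (X0 := PSeries cot_coef ((t / 2) ^ 2)) in *.
  set (X1 := PSeries cot_coef ((INR (S q) * t / 2) ^ 2)) in *.
  assert (C0' : X0 * s = t / 2 * c).
  { apply C0. unfold Rdiv; rewrite Rabs_mult, (Rabs_right (/ 2)); lra. }
  assert (C1' : X1 * (D * s) = INR (S q) * t / 2 * c1).
  { apply C1. unfold Rdiv. rewrite !Rabs_mult, (Rabs_right (/ 2)), S_INR, Rabs_right by lra.
    assert (M : (INR q + 1) * Rabs t < (INR q + 1) * / (INR q + 1))
      by (apply Rmult_lt_compat_l; lra).
    rewrite Rinv_r in M by lra. lra. }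
  (* For [0 < |t| < 1] the factor [t sin (t/2)] is nonzero and may be cancelled. *)
  apply Rmult_eq_reg_r with (t * s); [|apply Rmult_integral_contrapositive; auto].
  replace (2 * t * p * D * (t * s)) with (2 * t ^ 2 * p * (D * s)) by ring.
  rewrite F, Rmult_minus_distr_r, C1'.
  replace (X0 * (D * s)) with (X0 * s * D) by ring. rewrite C0'.
  replace (d * (t * s)) with (t * (d * s)) by ring.
  replace (d * s) with (INR (S q) / 2 * c1 - D * (/ 2 * c)) by lra. field.
Qed.

(** The derivative of [D e^(-K)] is zero, so this product keeps its value [q + 1] at 0. The mean
    value theorem asks for derivatives on the open interval only, so the point 0, excluded in
    [is_derive_dirichlet], is harmless; evenness covers negative [t]. *)
Lemma dirichlet_exp_K q t :
  Rabs t < / (INR q + 1) -> dirichlet q t / (1 + INR q) = exp (Kfun q t).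
Proof.
  assert (Hq := pos_INR q).
  assert (Pos : forall t, 0 <= t < / (INR q + 1) -> dirichlet q t = (INR q + 1) * exp (Kfun q t)).
  { clear t; intros t Ht.
    set (f := fun t => dirichlet q t * exp (- Kfun q t)).
    assert (Small : forall x, Rmin 0 t <= x <= Rmax 0 t -> 0 <= x /\ Rabs x < / (INR q + 1)).
    { intros x. rewrite Rmin_left, Rmax_right by lra. intros Hx; split; [lra|].
      rewrite Rabs_right; lra. }
    destruct (MVT_gen f 0 t (fun _ => 0)) as [c [_ Hc]].
    - intros x Hx. destruct (Small x) as [S0 S1]; [lra|].
      rewrite Rmin_left, Rmax_right in Hx by lra.
      set (p := PSeries (PS_derive (kappa q)) (x ^ 2)).
      assert (D1 := is_derive_dirichlet q x ltac:(lra) S1). fold p in D1.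
      assert (D2 : is_derive (fun t => exp (- Kfun q t)) x (- (2 * x * p) * exp (- Kfun q x))).
      { apply (is_derive_comp exp (fun t => - Kfun q t)).
        - apply is_derive_exp.
        - apply (is_derive_opp (Kfun q)), is_derive_Kfun, S1. }
      replace 0 with (2 * x * p * dirichlet q x * exp (- Kfun q x) +
        dirichlet q x * (- (2 * x * p) * exp (- Kfun q x))) by ring.
      apply (is_derive_mult (dirichlet q) (fun t => exp (- Kfun q t)) x); auto.
      intros; apply Rmult_comm.
    - intros x Hx. destruct (Small x) as [S0 S1]; [lra|].
      apply continuity_pt_filterlim.
      apply (continuous_mult (dirichlet q) (fun t => exp (- Kfun q t))).
      + apply continuous_dirichlet.
      + apply (ex_derive_continuous (V := R_NormedModule)).
        apply (ex_derive_comp exp (fun t => - Kfun q t)).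
        * eexists; apply is_derive_exp.
        * eexists; apply (is_derive_opp (Kfun q)), is_derive_Kfun, S1.
    - rewrite Rmult_0_l in Hc. unfold f in Hc.
      rewrite dirichlet_at_0 in Hc. unfold Kfun at 2 in Hc.
      replace (0 ^ 2) with 0 in Hc by ring. rewrite PSeries_0, kappa_0, Ropp_0, exp_0 in Hc.
      replace (dirichlet q t) with (dirichlet q t * exp (- Kfun q t) * exp (Kfun q t)).
      + replace (dirichlet q t * exp (- Kfun q t)) with (INR q + 1) by lra. reflexivity.
      + rewrite Rmult_assoc, <- exp_plus, Rplus_opp_l, exp_0; ring. }
  intros Ht. assert (E : dirichlet q t = (INR q + 1) * exp (Kfun q t)).
  { destruct (Rle_dec 0 t) as [H|H].
    - apply Pos. rewrite Rabs_right in Ht; lra.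
    - rewrite <- dirichlet_neg, <- Kfun_neg. apply Pos. rewrite Rabs_left in Ht; lra. }
  rewrite E; field; lra.
Qed.

Lemma CV_radius_decr_n (a : nat -> R) n : CV_radius (PS_decr_n a n) = CV_radius a.
Proof.
  induction n as [|n IH].
  - apply CV_radius_ext; reflexivity.
  - rewrite <- IH, <- (CV_radius_decr_1 (PS_decr_n a n)). apply CV_radius_ext; intros k.
    unfold PS_decr_n, PS_decr_1. f_equal; lia.
Qed.

(** After factoring out [x^(m+1)], the shifted series is dominated by its absolute series at [r]. *)
Lemma PSeries_remainder (a : nat -> R) (r : R) (m : nat) :
  0 < r -> Rbar_lt r (CV_radius a) ->
  exists C, 0 <= C /\ forall x, Rabs x <= r ->
    Rabs (PSeries a x - sum_f_R0 (fun k => a k * x ^ k) m) <= C * Rabs x ^ S m.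
Proof.
  intros Hr Ha.
  assert (Hr' : Rbar_lt (Rabs r) (CV_radius a)) by (rewrite Rabs_right; auto; lra).
  set (c := PS_decr_n a (S m)).
  assert (Abs : ex_series (fun k => Rabs (c k * r ^ k))).
  { apply CV_disk_inside. unfold c.
    rewrite CV_radius_decr_n. auto. }
  exists (Series (fun k => Rabs (c k * r ^ k))). split.
  - eapply Rle_trans; [apply Rabs_pos|apply Series_Rabs; exact Abs].
  - intros x Hx.
    assert (Hx' : Rbar_lt (Rabs x) (CV_radius a)).
    { apply Rbar_le_lt_trans with r; auto. }
    rewrite (PSeries_decr_n a m x) by (apply CV_radius_inside; auto). fold c.
    replace (_ + _ - _) with (x ^ S m * PSeries c x) by ring.
    rewrite Rabs_mult, <- RPow_abs, Rmult_comm.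
    apply Rmult_le_compat_r; [apply pow_le, Rabs_pos|].
    assert (Lec : forall n, 0 <= Rabs (c n * x ^ n) <= Rabs (c n * r ^ n)).
    { intros n; split; [apply Rabs_pos|]. rewrite !Rabs_mult.
      apply Rmult_le_compat_l; [apply Rabs_pos|].
      rewrite <- !RPow_abs. apply pow_incr. split; [apply Rabs_pos|].
      rewrite (Rabs_right r); lra. }
    eapply Rle_trans; [apply Series_Rabs|apply Series_le; auto].
    apply (ex_series_le (K := R_AbsRing) (V := R_CompleteNormedModule) _
             (fun k => Rabs (c k * r ^ k))); auto.
    intros n. unfold norm; simpl; unfold abs; simpl. rewrite Rabs_Rabsolu. apply Lec.
Qed.

(** * Expansion of a product of exponentials *)

(** The parameter [m] is the index attached to the head of the tuple; carrying it makes recursion on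
    the tuple possible. *)
Fixpoint term (a : nat -> R) (m : nat) (l : list nat) : R :=
  match l with
  | nil => 1
  | k :: l' => a m ^ k / INR (fact k) * term a (S m) l'
  end.

Fixpoint wt (m : nat) (l : list nat) : nat :=
  match l with
  | nil => 0%nat
  | k :: l' => (m * k + wt (S m) l')%nat
  end.

(* Coefficient of [h^nu] in [prod_(m <= i < m + len) sum_(k <= b) (a_i h^i)^k / k!] *)
Definition wsum (a : nat -> R) (m len b nu : nat) : R :=
  sumR (map (fun l => if Nat.eqb (wt m l) nu then term a m l else 0) (tuples len b)).

Lemma sumR_flat_map {A B} (f : B -> R) (g : A -> list B) l :
  sumR (map f (flat_map g l)) = sumR (map (fun a => sumR (map f (g a))) l).
Proof.
  induction l as [|a l IH]; [reflexivity|].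
  simpl flat_map. rewrite map_app, sumR_app, IH. reflexivity.
Qed.

Lemma sumR_ext {A} (f g : A -> R) l :
  (forall a, In a l -> f a = g a) -> sumR (map f l) = sumR (map g l).
Proof. intros H; apply (f_equal sumR), map_ext_in, H. Qed.

Lemma sumR_zero {A} (f : A -> R) l :
  (forall a, In a l -> f a = 0) -> sumR (map f l) = 0.
Proof.
  induction l as [|a l IH]; intros H; [reflexivity|].
  change (f a + sumR (map f l) = 0). rewrite IH, H; [ring| |]; intros; try apply H; simpl; auto.
Qed.

Lemma sumR_nonneg {A} (f : A -> R) l :
  (forall a, 0 <= f a) -> 0 <= sumR (map f l).
Proof.
  intros H. rewrite <- (sumR_zero (fun _ => 0) l) by auto. apply sumR_le; auto.
Qed.

Lemma sumR_swap {A B} (f : A -> B -> R) l1 l2 :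
  sumR (map (fun a => sumR (map (f a) l2)) l1) =
  sumR (map (fun b => sumR (map (fun a => f a b) l1)) l2).
Proof.
  induction l1 as [|a l1 IH].
  - symmetry; apply sumR_zero; reflexivity.
  - change (sumR (map (f a) l2) + sumR (map (fun a => sumR (map (f a) l2)) l1) =
      sumR (map (fun b => f a b + sumR (map (fun a => f a b) l1)) l2)).
    rewrite IH, sumR_plus; reflexivity.
Qed.

Lemma sumR_delta (g : nat -> R) w n :
  sumR (map (fun nu => if Nat.eqb w nu then g nu else 0) (seq 0 (S n))) =
  if Nat.leb w n then g w else 0.
Proof.
  induction n as [|n IH].
  - unfold sumR; simpl. destruct w; simpl; ring.
  - rewrite seq_S, map_app, sumR_app, IH.
    change (sumR (map _ ((0 + S n)%nat :: nil))) with ((if Nat.eqb w (S n) then g (S n) else 0) + 0).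
    destruct (Nat.eqb_spec w (S n)) as [E|E]; destruct (Nat.leb_spec w n);
      destruct (Nat.leb_spec w (S n)); try lia; try rewrite E; ring.
Qed.

Lemma sumR_filter {A} (p : A -> bool) (f : A -> R) l :
  sumR (map f (filter p l)) = sumR (map (fun a => if p a then f a else 0) l).
Proof.
  induction l as [|a l IH]; [reflexivity|]. simpl filter.
  change (sumR (map f (if p a then a :: filter p l else filter p l)) =
    (if p a then f a else 0) + sumR (map (fun a => if p a then f a else 0) l)).
  rewrite <- IH. destruct (p a); [reflexivity|ring].
Qed.

Lemma sumR_tuples_S (f : list nat -> R) len b :
  sumR (map f (tuples (S len) b)) =
  sumR (map (fun k => sumR (map (fun l => f (k :: l)) (tuples len b))) (seq 0 (S b))).
Proof.
  change (tuples (S len) b) with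
    (flat_map (fun a => map (cons a) (tuples len b)) (seq 0 (S b))).
  rewrite sumR_flat_map. apply sumR_ext; intros k _. rewrite map_map. reflexivity.
Qed.

Lemma wsum_S a m len b nu :
  wsum a m (S len) b nu =
  sumR (map (fun k => if Nat.leb (m * k) nu
      then a m ^ k / INR (fact k) * wsum a (S m) len b (nu - m * k) else 0) (seq 0 (S b))).
Proof.
  unfold wsum. rewrite sumR_tuples_S. apply sumR_ext; intros k _.
  destruct (Nat.leb_spec (m * k) nu).
  - rewrite <- sumR_scal. apply sumR_ext; intros l _. cbn [wt term].
    destruct (Nat.eqb_spec (m * k + wt (S m) l) nu);
      destruct (Nat.eqb_spec (wt (S m) l) (nu - m * k)); try lia; try reflexivity; ring.
  - apply sumR_zero; intros l _. cbn [wt].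
    destruct (Nat.eqb_spec (m * k + wt (S m) l) nu); [lia|reflexivity].
Qed.

Lemma sumR_truncate (f : nat -> R) b nu :
  (nu <= b)%nat -> (forall k, (nu < k)%nat -> f k = 0) ->
  sumR (map f (seq 0 (S b))) = sumR (map f (seq 0 (S nu))).
Proof.
  intros H Z. replace (S b) with (S nu + (b - nu))%nat by lia.
  rewrite seq_app, map_app, sumR_app, (sumR_zero f (seq (0 + S nu) _)); [ring|].
  intros k Hk; apply in_seq in Hk; apply Z; lia.
Qed.

Lemma wsum_bound_irrel a m len b nu :
  (1 <= m)%nat -> (nu <= b)%nat -> wsum a m len b nu = wsum a m len nu nu.
Proof.
  revert m b nu; induction len as [|len IH]; intros m b nu Hm Hb; [reflexivity|].
  rewrite !wsum_S, (sumR_truncate _ b nu Hb).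
  - apply sumR_ext; intros k _. destruct (Nat.leb_spec (m * k) nu); [|reflexivity].
    rewrite IH, (IH _ nu) by lia. reflexivity.
  - intros k Hk. destruct (Nat.leb_spec (m * k) nu); [nia|reflexivity].
Qed.

Lemma wsum_large_index a m len b nu :
  (nu < m)%nat -> wsum a m len b nu = if Nat.eqb nu 0 then 1 else 0.
Proof.
  revert m b nu; induction len as [|len IH]; intros m b nu Hm.
  - unfold wsum, sumR; simpl. destruct nu; simpl; ring.
  - rewrite wsum_S, (sumR_truncate _ b 0); [|lia|].
    + unfold sumR; simpl seq; simpl map; simpl fold_right.
      rewrite Nat.mul_0_r, Nat.sub_0_r, IH by lia. simpl; field.
    + intros k Hk. destruct (Nat.leb_spec (m * k) nu); [nia|reflexivity].
Qed.

Lemma wsum_len_irrel a m len len' b nu :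
  (1 <= m)%nat -> (nu < m + len)%nat -> (nu < m + len')%nat ->
  wsum a m len b nu = wsum a m len' b nu.
Proof.
  revert m len' b nu; induction len as [|len IH]; intros m len' b nu Hm H H'.
  - rewrite !wsum_large_index by lia. reflexivity.
  - destruct len' as [|len']; [rewrite !wsum_large_index by lia; reflexivity|].
    rewrite !wsum_S. apply sumR_ext; intros k _.
    destruct (Nat.leb_spec (m * k) nu); [|reflexivity].
    rewrite (IH (S m) len') by lia. reflexivity.
Qed.

(** A tuple of weight [nu] has no multiplicity above [nu], and multiplicity zero at every index
    above [nu]. So truncating at any order [b >= nu] gives the coefficient over the index set of the
    theorem. *)
Lemma wsum_stable a b nu :
  (nu <= b)%nat -> wsum a 1 b b nu = wsum a 1 nu nu nu.
Proof.
  intros H. rewrite wsum_bound_irrel by lia. apply wsum_len_irrel; lia.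
Qed.

(** * Truncated exponentials and their remainders *)

Definition texp (b : nat) (z : R) : R := sumR (map (fun k => z ^ k / INR (fact k)) (seq 0 (S b))).

Lemma prod_texp b (z : nat -> R) m len :
  prodR (map (fun i => texp b (z i)) (seq m len)) = sumR (map (term z m) (tuples len b)).
Proof.
  revert m; induction len as [|len IH]; intros m.
  - unfold prodR, sumR; simpl; ring.
  - rewrite sumR_tuples_S.
    change (texp b (z m) * prodR (map (fun i => texp b (z i)) (seq (S m) len)) =
      sumR (map (fun k => sumR (map (fun l => z m ^ k / INR (fact k) * term z (S m) l) (tuples len b)))
       (seq 0 (S b)))).
    rewrite IH. unfold texp. rewrite Rmult_comm, <- sumR_scal.
    apply sumR_ext; intros k _. rewrite sumR_scal; ring.
Qed.

Lemma term_scale a h m l : term (fun i => a i * h ^ i) m l = term a m l * h ^ wt m l.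
Proof.
  revert m; induction l as [|k l IH]; intros m; cbn [term wt]; [simpl; ring|].
  rewrite IH, Rpow_mult_distr, pow_add, pow_mult. unfold Rdiv; ring.
Qed.

(** Tuples are sorted by weight: weights up to [b] form the main polynomial in [h], while the others
    carry at least [h^(b+1)]. *)
Lemma wsum_group a h b :
  sumR (map (term (fun i => a i * h ^ i) 1) (tuples b b)) =
  sumR (map (fun nu => wsum a 1 nu nu nu * h ^ nu) (seq 0 (S b))) +
  sumR (map (fun l => if Nat.leb (wt 1 l) b then 0 else term a 1 l * h ^ wt 1 l) (tuples b b)).
Proof.
  rewrite (sumR_ext (fun nu => wsum a 1 nu nu nu * h ^ nu)
    (fun nu => sumR (map (fun l => if Nat.eqb (wt 1 l) nu then term a 1 l * h ^ nu else 0)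
       (tuples b b)))).
  - rewrite sumR_swap, <- sumR_plus. apply sumR_ext; intros l _.
    rewrite (sumR_delta (fun nu => term a 1 l * h ^ nu)), term_scale.
    destruct (Nat.leb (wt 1 l) b); ring.
  - intros nu Hnu. apply in_seq in Hnu. rewrite <- (wsum_stable a b) by lia.
    unfold wsum. rewrite Rmult_comm, <- sumR_scal. apply sumR_ext; intros l _.
    destruct (Nat.eqb (wt 1 l) nu); ring.
Qed.

Lemma texp_S b z : texp (S b) z = texp b z + z ^ S b / INR (fact (S b)).
Proof. unfold texp; rewrite seq_S, map_app, sumR_app; unfold sumR; simpl; ring. Qed.

Lemma is_derive_texp b z : is_derive (texp (S b)) z (texp b z).
Proof.
  induction b as [|b IH].
  - apply (is_derive_ext (fun z => 1 + z)).
    + intros t; unfold texp, sumR; simpl; field.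
    + replace (texp 0 z) with 1 by (unfold texp, sumR; simpl; field).
      auto_derive; auto; ring.
  - apply (is_derive_ext (fun z => texp (S b) z + z ^ S (S b) / INR (fact (S (S b))))).
    + intros t; rewrite (texp_S (S b)); reflexivity.
    + rewrite texp_S. apply (is_derive_plus (texp (S b))); auto.
      rewrite (fact_simpl (S b)), mult_INR. generalize (INR_fact_neq_0 (S b)).
      generalize (INR (fact (S b))). intros f Hf.
      assert (INR (S (S b)) <> 0) by (apply not_0_INR; lia).
      assert (Dp : forall n c, is_derive (fun z => z ^ n / c) z (INR n * z ^ Nat.pred n / c)).
      { intros n c. auto_derive; auto. unfold Rdiv; ring. }
      replace (z ^ S b / f) with
        (INR (S (S b)) * z ^ Nat.pred (S (S b)) / (INR (S (S b)) * f)) by (cbn [Nat.pred]; field; auto).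
      apply Dp.
Qed.

Lemma MVT_from_0 (f df : R -> R) (M z : R) :
  (forall x, is_derive f x (df x)) -> f 0 = 0 ->
  (forall x, Rabs x <= Rabs z -> Rabs (df x) <= M) -> Rabs (f z) <= Rabs z * M.
Proof.
  intros Hd H0 HM. destruct (MVT_gen f 0 z df) as [c [Hc E]].
  - intros; apply Hd.
  - intros x _. apply continuity_pt_filterlim.
    apply (ex_derive_continuous (V := R_NormedModule)); eexists; apply Hd.
  - rewrite H0, !Rminus_0_r in E. rewrite E, Rabs_mult, Rmult_comm.
    apply Rmult_le_compat_l; [apply Rabs_pos|]. apply HM.
    revert Hc; unfold Rmin, Rmax; destruct (Rle_dec 0 z); intros Hc;
      [rewrite !Rabs_right|rewrite !Rabs_left1]; lra.
Qed.

Lemma exp_le x y : x <= y -> exp x <= exp y.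
Proof. intros [H|H]; [left; apply exp_increasing, H|rewrite H; lra]. Qed.

Lemma texp_at_0 b : texp b 0 = 1.
Proof.
  induction b as [|b IH]; [unfold texp, sumR; simpl; field|].
  rewrite texp_S, IH, pow_ne_zero by lia. unfold Rdiv; ring.
Qed.

(** Induction by the mean value theorem, as the derivative of one remainder is the previous
    remainder. *)
Lemma texp_remainder b z : Rabs (exp z - texp b z) <= Rabs z ^ S b * exp (Rabs z).
Proof.
  revert z; induction b as [|b IH]; intros z.
  - rewrite pow_1. apply (MVT_from_0 (fun z => exp z - texp 0 z) exp).
    + intros x. apply (is_derive_ext (fun z => exp z - 1)).
      * intros t; unfold texp, sumR; simpl; field.
      * auto_derive; auto; ring.
    + rewrite exp_0, texp_at_0; ring.
    + intros x Hx. rewrite Rabs_right by (apply Rle_ge, Rlt_le, exp_pos).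
      apply exp_le. eapply Rle_trans; [apply Rle_abs|exact Hx].
  - rewrite <- tech_pow_Rmult, Rmult_assoc.
    apply (MVT_from_0 (fun z => exp z - texp (S b) z) (fun z => exp z - texp b z)).
    + intros x. apply (is_derive_minus exp (texp (S b))).
      * apply is_derive_exp.
      * apply is_derive_texp.
    + rewrite exp_0, texp_at_0; ring.
    + intros x Hx. eapply Rle_trans; [apply IH|].
      apply Rmult_le_compat; [apply pow_le, Rabs_pos|left; apply exp_pos| |apply exp_le, Hx].
      apply pow_incr; split; [apply Rabs_pos|exact Hx].
Qed.

Lemma texp_bound b z : Rabs (texp b z) <= exp (Rabs z).
Proof.
  eapply Rle_trans; [apply sumR_abs|].
  eapply Rle_trans; [|apply (exp_ge_taylor (Rabs z) b), Rabs_pos].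
  rewrite <- sumR_sum_f_R0. apply sumR_le; intros k _.
  unfold Rdiv. rewrite Rabs_mult, <- RPow_abs, Rabs_inv.
  rewrite (Rabs_right (INR _)) by (apply Rle_ge, pos_INR). lra.
Qed.

Lemma prod_texp_remainder b (z : nat -> R) l :
  Rabs (exp (sumR (map z l)) - prodR (map (fun i => texp b (z i)) l)) <=
  sumR (map (fun i => Rabs (z i) ^ S b) l) * exp (sumR (map (fun i => Rabs (z i)) l)).
Proof.
  induction l as [|i l IH].
  - unfold sumR, prodR; simpl. rewrite exp_0, Rminus_diag, Rabs_R0; lra.
  - change (Rabs (exp (z i + sumR (map z l)) - texp b (z i) * prodR (map (fun i => texp b (z i)) l)) <=
      (Rabs (z i) ^ S b + sumR (map (fun i => Rabs (z i) ^ S b) l)) *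
      exp (Rabs (z i) + sumR (map (fun i => Rabs (z i)) l))).
    rewrite !exp_plus. revert IH.
    assert (E0 : Rabs (exp (sumR (map z l))) <= exp (sumR (map (fun i => Rabs (z i)) l))).
    { rewrite Rabs_right by (apply Rle_ge, Rlt_le, exp_pos). apply exp_le.
      apply sumR_le; intros; apply Rle_abs. }
    assert (T := texp_remainder b (z i)). assert (B := texp_bound b (z i)). revert E0 T B.
    generalize (exp (sumR (map z l))) (prodR (map (fun i => texp b (z i)) l))
      (sumR (map (fun i => Rabs (z i) ^ S b) l)) (exp (sumR (map (fun i => Rabs (z i)) l)))
      (exp (z i)) (texp b (z i)) (exp (Rabs (z i))) (Rabs (z i) ^ S b).
    intros E P S X e t x p E0 T B IH.
    (* Telescoping: one factor is replaced at a time. *)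
    replace (e * E - t * P) with ((e - t) * E + t * (E - P)) by ring.
    eapply Rle_trans; [apply Rabs_triang|]. rewrite !Rabs_mult.
    replace ((p + S) * (x * X)) with (p * x * X + x * (S * X)) by ring.
    apply Rplus_le_compat; apply Rmult_le_compat; auto; apply Rabs_pos.
Qed.

(** * Polynomial bounds and the local expansion *)

Definition poly_bounded (f : R -> R) : Prop :=
  exists C J, 0 <= C /\ forall y, 0 <= y -> Rabs (f y) <= C * (1 + y) ^ J.

Lemma poly_bounded_monomial c k : poly_bounded (fun y => c * y ^ k).
Proof.
  exists (Rabs c), k. split; [apply Rabs_pos|]. intros y Hy.
  rewrite Rabs_mult, (Rabs_right (y ^ k)) by (apply Rle_ge, pow_le, Hy).
  apply Rmult_le_compat_l; [apply Rabs_pos|]. apply pow_incr; lra.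
Qed.

Lemma poly_bounded_plus f g :
  poly_bounded f -> poly_bounded g -> poly_bounded (fun y => f y + g y).
Proof.
  intros [C [J [HC Hf]]] [C' [J' [HC' Hg]]].
  exists (C + C'), (J + J')%nat. split; [lra|]. intros y Hy.
  eapply Rle_trans; [apply Rabs_triang|]. rewrite Rmult_plus_distr_r.
  apply Rplus_le_compat; (eapply Rle_trans; [eauto|]); apply Rmult_le_compat_l; auto;
    apply Rle_pow; try lra; lia.
Qed.

Lemma poly_bounded_sum {A} (f : A -> R -> R) l :
  (forall a, poly_bounded (f a)) -> poly_bounded (fun y => sumR (map (fun a => f a y) l)).
Proof.
  intros H; induction l as [|a l IH].
  - exists 0, 0%nat. split; [lra|]. intros; unfold sumR; simpl. rewrite Rabs_R0; lra.
  - apply (poly_bounded_plus (f a)); auto.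
Qed.

Lemma poly_bounded_abs f : poly_bounded f -> poly_bounded (fun y => Rabs (f y)).
Proof.
  intros [C [J [HC H]]]; exists C, J; split; auto. intros; rewrite Rabs_Rabsolu; auto.
Qed.

(** Index [i] comes with [y^(i+1)], so the degree is the weight plus the number of parts. With
    [y = t^2] this is the source of the Hermite index [2(nu + s)]. *)
Lemma term_monomial (b : nat -> R) y m l :
  term (fun i => b i * y ^ S i) m l = term b m l * y ^ (wt m l + sumN l).
Proof.
  revert m; induction l as [|k l IH]; intros m; cbn [term wt]; [simpl; ring|].
  change (sumN (k :: l)) with (k + sumN l)%nat. rewrite IH, Rpow_mult_distr, <- pow_mult.
  replace (m * k + wt (S m) l + (k + sumN l))%nat with (S m * k + (wt (S m) l + sumN l))%nat
    by lia. rewrite (pow_add y (S m * k)). unfold Rdiv; ring.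
Qed.

(** Coefficient of [h^nu] in [exp (sum_i b_i y^(i+1) h^i)], a polynomial in [y]. *)
Definition edge_poly (b : nat -> R) (nu : nat) (y : R) : R :=
  wsum (fun i => b i * y ^ S i) 1 nu nu nu.

Lemma edge_poly_bounded b nu : poly_bounded (edge_poly b nu).
Proof.
  apply poly_bounded_sum; intros l. destruct (Nat.eqb (wt 1 l) nu).
  - destruct (poly_bounded_monomial (term b 1 l) (wt 1 l + sumN l)) as [C [J [HC H]]].
    exists C, J; split; auto; intros y Hy. rewrite term_monomial; auto.
  - exists 0, 0%nat; split; [lra|]; intros; rewrite Rabs_R0; lra.
Qed.

Lemma pow_decr (h : R) (m n : nat) : 0 <= h <= 1 -> (m <= n)%nat -> h ^ n <= h ^ m.
Proof.
  intros Hh Hm. replace n with (m + (n - m))%nat by lia. rewrite pow_add.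
  rewrite <- (Rmult_1_r (h ^ m)) at 2. apply Rmult_le_compat_l; [apply pow_le; lra|].
  rewrite <- (pow1 (n - m)). apply pow_incr; lra.
Qed.

(** Each summand is [b_i y (y h)^i], so for [y h <= d] the exponent is at most [c y], with [c] as
    small as desired. Truncating the exponentials and dropping the tuples of weight above [L] both
    cost [h^(L+1)] times a polynomial in [y]. *)
Lemma edgeworth_local (b : nat -> R) (L : nat) (c : R) :
  0 < c -> exists C J d, 0 <= C /\ 0 < d <= 1 /\ forall y h, 0 <= y -> 0 < h <= 1 -> y * h <= d ->
    Rabs (sumR (map (fun i => b i * y ^ S i * h ^ i) (seq 1 L))) <= c * y /\
    Rabs (exp (sumR (map (fun i => b i * y ^ S i * h ^ i) (seq 1 L))) -
          sumR (map (fun nu => edge_poly b nu y * h ^ nu) (seq 0 (S L)))) <=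
    C * (1 + y) ^ J * h ^ S L * exp (c * y).
Proof.
  intros Hc.
  set (B := sumR (map (fun i => Rabs (b i)) (seq 1 L))).
  assert (HB : 0 <= B).
  { apply sumR_nonneg; intros; apply Rabs_pos. }
  assert (P1 : poly_bounded (fun y =>
    sumR (map (fun i => Rabs (Rabs (b i) ^ S L * y ^ (S i * S L))) (seq 1 L)))).
  { apply poly_bounded_sum; intros i. apply poly_bounded_abs, poly_bounded_monomial. }
  assert (P2 : poly_bounded (fun y => sumR (map (fun l => if Nat.leb (wt 1 l) L then 0 else
      Rabs (term b 1 l * y ^ (wt 1 l + sumN l))) (tuples L L)))).
  { apply poly_bounded_sum; intros l. destruct (Nat.leb (wt 1 l) L).
    - exists 0, 0%nat; split; [lra|]; intros; rewrite Rabs_R0; lra.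
    - apply poly_bounded_abs, poly_bounded_monomial. }
  destruct (poly_bounded_plus _ _ P1 P2) as [C [J [HC H]]].
  (* The bound [d <= 1] gives [(y h)^i <= y h], and [d B <= c] accounts for the sum of the
     coefficients; the [+ 1] guards against [B = 0]. *)
  set (d := Rmin 1 (c / (B + 1))).
  assert (Hd : 0 < d <= 1).
  { split; [|apply Rmin_l]. apply Rmin_glb_lt; [lra|]. apply Rdiv_lt_0_compat; lra. }
  assert (HdB : d * B <= c).
  { apply Rle_trans with (c / (B + 1) * B).
    - apply Rmult_le_compat_r; [lra|apply Rmin_r].
    - replace (c / (B + 1) * B) with (c - c / (B + 1)) by (field; lra).
      assert (0 < c / (B + 1)) by (apply Rdiv_lt_0_compat; lra). lra. }
  exists C, J, d. split; [exact HC|]. split; [exact Hd|]. intros y h Hy Hh Hyh.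
  set (z := fun i => b i * y ^ S i * h ^ i).
  assert (Hyh0 : 0 <= y * h) by (apply Rmult_le_pos; lra).
  assert (Sz : sumR (map (fun i => Rabs (z i)) (seq 1 L)) <= c * y).
  { apply Rle_trans with (sumR (map (fun i => d * y * Rabs (b i)) (seq 1 L))).
    - apply sumR_le; intros i Hi. apply in_seq in Hi. unfold z.
      replace (b i * y ^ S i * h ^ i) with (b i * (y * (y * h) ^ i))
        by (rewrite Rpow_mult_distr; simpl; ring).
      rewrite Rabs_mult, Rmult_comm. apply Rmult_le_compat_r; [apply Rabs_pos|].
      rewrite Rabs_right by (apply Rle_ge, Rmult_le_pos; auto; apply pow_le, Hyh0).
      rewrite Rmult_comm. apply Rmult_le_compat_r; [lra|].
      apply Rle_trans with (y * h); [|lra].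
      rewrite <- (pow_1 (y * h)) at 2. apply pow_decr; [lra|lia].
    - rewrite sumR_scal. fold B. replace (d * y * B) with (d * B * y) by ring.
      apply Rmult_le_compat_r; auto. }
  split; [eapply Rle_trans; [apply sumR_abs|exact Sz]|].
  assert (R1 := prod_texp_remainder L z (seq 1 L)).
  rewrite prod_texp in R1.
  change (term z 1) with (term (fun i => (fun i => b i * y ^ S i) i * h ^ i) 1) in R1.
  rewrite wsum_group in R1.
  change (fun nu => wsum (fun i => b i * y ^ S i) 1 nu nu nu * h ^ nu) with
    (fun nu => edge_poly b nu y * h ^ nu) in R1.
  set (Main := sumR (map (fun nu => edge_poly b nu y * h ^ nu) (seq 0 (S L)))) in *.
  set (Rest := sumR (map (fun l => if Nat.leb (wt 1 l) L then 0 else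
     term (fun i => b i * y ^ S i) 1 l * h ^ wt 1 l) (tuples L L))) in *.
  assert (HhL : 0 < h ^ S L) by (apply pow_lt; lra).
  assert (E1 : 1 <= exp (c * y)).
  { rewrite <- exp_0. apply exp_le, Rmult_le_pos; lra. }
  (* Since [i >= 1], the power [|z_i|^(L+1)] contains [h^(i (L+1)) <= h^(L+1)]. *)
  assert (A1 : sumR (map (fun i => Rabs (z i) ^ S L) (seq 1 L)) <=
    sumR (map (fun i => Rabs (Rabs (b i) ^ S L * y ^ (S i * S L))) (seq 1 L)) * h ^ S L).
  { rewrite Rmult_comm, <- sumR_scal. apply sumR_le; intros i Hi. apply in_seq in Hi.
    unfold z. rewrite !Rabs_mult, !Rpow_mult_distr, <- !RPow_abs, Rabs_Rabsolu.
    rewrite (Rabs_right y), (Rabs_right h), <- !pow_mult by lra.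
    rewrite Rmult_comm. apply Rmult_le_compat_r.
    - apply Rmult_le_pos; apply pow_le; [apply Rabs_pos|lra].
    - apply pow_decr; [lra|nia]. }
  assert (A2 : Rabs Rest <= sumR (map (fun l => if Nat.leb (wt 1 l) L then 0 else
      Rabs (term b 1 l * y ^ (wt 1 l + sumN l))) (tuples L L)) * h ^ S L).
  { eapply Rle_trans; [apply sumR_abs|]. rewrite Rmult_comm, <- sumR_scal.
    apply sumR_le; intros l _. destruct (Nat.leb_spec (wt 1 l) L).
    - rewrite Rabs_R0; lra.
    - rewrite term_monomial, Rabs_mult, Rmult_comm. apply Rmult_le_compat_r; [apply Rabs_pos|].
      rewrite Rabs_right by (apply Rle_ge, pow_le; lra). apply pow_decr; [lra|lia]. }
  specialize (H y Hy). cbv beta in H.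
  set (S1 := sumR (map (fun i => Rabs (Rabs (b i) ^ S L * y ^ (S i * S L))) (seq 1 L))) in *.
  set (S2 := sumR (map (fun l => if Nat.leb (wt 1 l) L then 0 else
      Rabs (term b 1 l * y ^ (wt 1 l + sumN l))) (tuples L L))) in *.
  assert (HS : S1 + S2 <= C * (1 + y) ^ J) by (eapply Rle_trans; [apply Rle_abs|exact H]).
  replace (exp (sumR (map z (seq 1 L))) - Main)
    with (exp (sumR (map z (seq 1 L))) - (Main + Rest) + Rest) by ring.
  eapply Rle_trans; [apply Rabs_triang|].
  apply Rle_trans with (S1 * h ^ S L * exp (c * y) + S2 * h ^ S L * exp (c * y)).
  - apply Rplus_le_compat.
    + eapply Rle_trans; [exact R1|]. apply Rmult_le_compat.
      * apply sumR_nonneg; intros; apply pow_le, Rabs_pos.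
      * left; apply exp_pos.
      * exact A1.
      * apply exp_le, Sz.
    + rewrite <- (Rmult_1_r (Rabs Rest)). apply Rmult_le_compat; auto; [apply Rabs_pos|lra].
  - rewrite <- Rmult_plus_distr_r, <- Rmult_plus_distr_r.
    apply Rmult_le_compat_r; [left; apply exp_pos|]. apply Rmult_le_compat_r; [lra|exact HS].
Qed.

(** * Pointwise bounds *)

(** The variance [((q+1)^2 - 1)/12] of the uniform law on [{0,...,q}]. *)
Definition variance (q : nat) : R := INR q * (INR q + 2) / 12.
(** Substituting [t^2 = y/(v n)] in [n kappa_(i+1) t^(2(i+1))] produces this coefficient times
    [y^(i+1) n^(-i)]. *)
Definition edge_coef (q i : nat) : R := kappa q (S i) / variance q ^ S i.
Definition edge_sum (q L : nat) (y h : R) : R :=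
  sumR (map (fun nu => edge_poly (edge_coef q) nu y * h ^ nu) (seq 0 (S L))).

Lemma variance_pos q : (1 <= q)%nat -> 0 < variance q.
Proof. intros H. apply (le_INR 1) in H. simpl in H. unfold variance. nra. Qed.

(** The quadratic term of the logarithm: after rescaling it is [-y/2], the Gaussian factor. *)
Lemma kappa_1 q : kappa q 1 = - variance q / 2.
Proof.
  unfold kappa, beta, variance. simpl Nat.mul. rewrite (proj2 bern_check).
  simpl. field.
Qed.

Lemma exp_ge_monomial z k : 0 <= z -> z ^ k / INR (fact k) <= exp z.
Proof.
  intros Hz. eapply Rle_trans; [|apply (exp_ge_taylor z k Hz)].
  destruct k as [|k]; [simpl; lra|]. rewrite tech5.
  assert (0 <= sum_f_R0 (fun k => z ^ k / INR (fact k)) k); [|lra].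
  apply cond_pos_sum; intros j. apply Rdiv_le_0_compat; [apply pow_le, Hz|apply INR_fact_lt_0].
Qed.

(** The Taylor term of degree [J + 1] of [exp (a (1 + y))] beats the polynomial; the shift by 1
    costs the factor [exp a]. *)
Lemma poly_exp_decay (a : R) (J : nat) :
  0 < a -> exists C, 0 <= C /\ forall y, 0 <= y -> (1 + y) ^ J * exp (- (a * y)) <= C / (1 + y).
Proof.
  intros Ha. assert (Hf := INR_fact_lt_0 (S J)).
  exists (INR (fact (S J)) / a ^ S J * exp a). split.
  - apply Rmult_le_pos; [|left; apply exp_pos].
    apply Rdiv_le_0_compat; [lra|apply pow_lt, Ha].
  - intros y Hy. apply Rmult_le_reg_r with (1 + y); [lra|].
    assert (Ap : 0 < a ^ S J) by (apply pow_lt, Ha).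
    replace (INR (fact (S J)) / a ^ S J * exp a / (1 + y) * (1 + y))
      with (INR (fact (S J)) / a ^ S J * exp a) by (field; lra).
    assert (H := exp_ge_monomial (a * (1 + y)) (S J) ltac:(nra)).
    replace (exp a) with (exp (a * (1 + y)) * exp (- (a * y)))
      by (rewrite <- exp_plus; f_equal; ring).
    replace ((1 + y) ^ J * exp (- (a * y)) * (1 + y)) with ((1 + y) ^ S J * exp (- (a * y)))
      by (simpl; ring).
    rewrite <- Rmult_assoc. apply Rmult_le_compat_r; [left; apply exp_pos|].
    apply Rle_trans with (INR (fact (S J)) / a ^ S J * ((a * (1 + y)) ^ S J / INR (fact (S J)))).
    + right. rewrite Rpow_mult_distr. field. lra.
    + apply Rmult_le_compat_l; [|exact H]. apply Rdiv_le_0_compat; lra.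
Qed.

Lemma edge_sum_bounded q L :
  exists C J, 0 <= C /\ forall y h, 0 <= y -> 0 < h <= 1 ->
    Rabs (edge_sum q L y h) <= C * (1 + y) ^ J.
Proof.
  destruct (poly_bounded_sum (fun nu y => Rabs (edge_poly (edge_coef q) nu y)) (seq 0 (S L)))
    as [C [J [HC H]]].
  { intros nu; apply poly_bounded_abs, edge_poly_bounded. }
  exists C, J. split; [exact HC|]. intros y h Hy Hh.
  eapply Rle_trans; [|apply H, Hy]. eapply Rle_trans; [|apply Rle_abs].
  eapply Rle_trans; [apply sumR_abs|]. apply sumR_le; intros nu _.
  rewrite Rabs_mult, (Rabs_right (h ^ nu)) by (apply Rle_ge, pow_le; lra).
  rewrite <- (Rmult_1_r (Rabs _)) at 2. apply Rmult_le_compat_l; [apply Rabs_pos|].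
  rewrite <- (pow_O h). apply pow_decr; [lra|lia].
Qed.

Lemma inv_INR_bounds n : (1 <= n)%nat -> 0 < / INR n <= 1.
Proof.
  intros H. apply (le_INR 1) in H. simpl in H. split; [apply Rinv_0_lt_compat; lra|].
  rewrite <- Rinv_1. apply Rinv_le_contravar; lra.
Qed.

Lemma exp_pow z n : exp z ^ n = exp (INR n * z).
Proof.
  induction n as [|n IH]; [simpl; rewrite Rmult_0_l, exp_0; reflexivity|].
  rewrite <- tech_pow_Rmult, IH, <- exp_plus, S_INR. f_equal; ring.
Qed.

(** Here [n Kfun q t = -y/2 + A + Rm], where [A] holds the terms kept and [Rm] is [n] times the
    series remainder. Each is at most [y/8] in absolute value, so half of the Gaussian exponent
    survives. *)
Lemma pointwise_near q L :
  (1 <= q)%nat ->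
  exists C J d, 0 <= C /\ 0 < d /\ forall n t, (1 <= n)%nat -> t ^ 2 <= d ->
    Rabs ((dirichlet q t / (1 + INR q)) ^ n -
          exp (- (variance q * INR n * t ^ 2 / 2)) * edge_sum q L (variance q * INR n * t ^ 2) (/ INR n))
    <= C * (1 + variance q * INR n * t ^ 2) ^ J * (/ INR n) ^ S L * exp (- (variance q * INR n * t ^ 2 / 4)).
Proof.
  intros Hq. assert (Hv := variance_pos q Hq). assert (Hq0 := pos_INR q).
  set (v := variance q) in *.
  set (r0 := / (INR q + 1) ^ 2).
  assert (Hr0 : 0 < r0) by (apply Rinv_0_lt_compat, pow_lt; lra).
  destruct (PSeries_remainder (kappa q) (r0 / 2) (S L)) as [C1 [HC1 Rem]]; [lra| |].
  { rewrite <- (Rabs_right (r0 / 2)) by lra. apply kappa_radius.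
    rewrite Rabs_right by lra. fold r0; lra. }
  destruct (edgeworth_local (edge_coef q) L (/ 8)) as [C2 [J [d2 [HC2 [Hd2 Loc]]]]]; [lra|].
  (* Chosen so that [n C1 t^2 d3 <= y/8]; the [+ 1] avoids a division by zero. *)
  set (d3 := v / (8 * (C1 + 1))).
  assert (Hd3 : 0 < d3) by (apply Rdiv_lt_0_compat; lra).
  exists (C1 / v ^ (S (S L)) + C2), (J + S (S L))%nat, (Rmin (Rmin 1 (r0 / 2)) (Rmin (d2 / v) d3)).
  assert (Hvp : 0 < v ^ S (S L)) by (apply pow_lt, Hv).
  assert (HC1v : 0 <= C1 / v ^ S (S L)) by (apply Rdiv_le_0_compat; lra).
  split; [lra|]. split.
  { repeat apply Rmin_glb_lt; try lra. apply Rdiv_lt_0_compat; lra. }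
  intros n t Hn Ht.
  assert (Ht1 : t ^ 2 <= 1) by (eapply Rle_trans; [exact Ht|eapply Rle_trans; apply Rmin_l]).
  assert (Htr : t ^ 2 <= r0 / 2)
    by (eapply Rle_trans; [exact Ht|eapply Rle_trans; [apply Rmin_l|apply Rmin_r]]).
  assert (Htd2 : t ^ 2 <= d2 / v)
    by (eapply Rle_trans; [exact Ht|eapply Rle_trans; [apply Rmin_r|apply Rmin_l]]).
  assert (Htd3 : t ^ 2 <= d3)
    by (eapply Rle_trans; [exact Ht|eapply Rle_trans; [apply Rmin_r|apply Rmin_r]]).
  clear Ht. assert (Hw0 : 0 <= t ^ 2) by apply pow2_ge_0.
  assert (Hh := inv_INR_bounds n Hn).
  assert (Hn0 : 0 < INR n) by (apply lt_0_INR; lia).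
  rewrite dirichlet_exp_K, exp_pow.
  2: { apply Rsqr_incrst_0; [|apply Rabs_pos|left; apply Rinv_0_lt_compat; lra].
       rewrite <- Rsqr_abs, !Rsqr_pow2, pow_inv. fold r0; lra. }
  specialize (Rem (t ^ 2)). rewrite (Rabs_right (t ^ 2)) in Rem by lra. specialize (Rem Htr).
  unfold Kfun. set (w := t ^ 2) in *. set (h := / INR n) in *.
  set (y := v * INR n * w) in *.
  assert (Hy : 0 <= y) by (unfold y; apply Rmult_le_pos; nra).
  assert (Hyh : y * h = v * w) by (unfold y, h; field; lra).
  assert (Hw : w = y * h / v) by (rewrite Hyh; field; lra).
  destruct (Loc y h Hy Hh) as [LA LB].
  { rewrite Hyh. apply Rmult_le_reg_r with (/ v); [apply Rinv_0_lt_compat, Hv|].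
    replace (v * w * / v) with w by (field; lra). exact Htd2. }
  clear Loc.
  set (A := sumR (map (fun i => edge_coef q i * y ^ S i * h ^ i) (seq 1 L))) in *.
  change (sumR (map (fun nu => edge_poly (edge_coef q) nu y * h ^ nu) (seq 0 (S L))))
    with (edge_sum q L y h) in LB.
  set (M := edge_sum q L y h) in *.
  set (Sm := sum_f_R0 (fun k => kappa q k * w ^ k) (S L)) in *.
  (* Index 0 contributes nothing, index 1 gives [-y/2], and the others form [A]. *)
  assert (HS : INR n * Sm = - y / 2 + A).
  { unfold Sm. rewrite <- sumR_sum_f_R0.
    change (seq 0 (S (S L))) with (0%nat :: 1%nat :: seq 2 L).
    rewrite <- seq_shift. cbn [map]. rewrite map_map.
    change (INR n * (kappa q 0 * w ^ 0 + (kappa q 1 * w ^ 1 +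
      sumR (map (fun i => kappa q (S i) * w ^ S i) (seq 1 L)))) = - y / 2 + A).
    rewrite kappa_0, kappa_1, Rmult_0_l, Rplus_0_l, Rmult_plus_distr_l. f_equal.
    - unfold y. fold v. field.
    - rewrite <- sumR_scal. apply sumR_ext; intros i _. unfold edge_coef. fold v.
      rewrite Hw. unfold Rdiv. rewrite !Rpow_mult_distr, pow_inv.
      rewrite <- (tech_pow_Rmult h). unfold h at 1. field. split; [apply pow_nonzero|]; lra. }
  set (Rm := INR n * (PSeries (kappa q) w - Sm)).
  replace (INR n * PSeries (kappa q) w) with (- (y / 2) + (A + Rm))
    by (unfold Rm; rewrite Rmult_minus_distr_l, HS; field).
  (* The factor [n] absorbs one of the [L + 2] powers of [h] in [w^(L+2)]. *)
  assert (HR1 : Rabs Rm <= C1 / v ^ S (S L) * y ^ S (S L) * h ^ S L).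
  { unfold Rm. rewrite Rabs_mult, Rabs_right by lra.
    apply Rle_trans with (INR n * (C1 * w ^ S (S L))).
    - apply Rmult_le_compat_l; [lra|exact Rem].
    - right. rewrite Hw. unfold Rdiv. rewrite !Rpow_mult_distr, pow_inv.
      rewrite <- (tech_pow_Rmult h). unfold h at 1. field. split; [apply pow_nonzero|]; lra. }
  assert (HR2 : Rabs Rm <= y / 8).
  { unfold Rm. rewrite Rabs_mult, Rabs_right by lra.
    apply Rle_trans with (INR n * (C1 * (w * d3))).
    - apply Rmult_le_compat_l; [lra|]. eapply Rle_trans; [exact Rem|].
      apply Rmult_le_compat_l; [lra|]. rewrite <- tech_pow_Rmult.
      apply Rmult_le_compat_l; [lra|]. apply Rle_trans with w; [|exact Htd3].
      rewrite <- (pow_1 w) at 2. apply pow_decr; [lra|lia].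
    - unfold d3, y. replace (INR n * (C1 * (w * (v / (8 * (C1 + 1))))))
        with (v * INR n * w / 8 * (C1 / (C1 + 1))) by (field; lra).
      rewrite <- (Rmult_1_r (v * INR n * w / 8)) at 2.
      apply Rmult_le_compat_l; [fold y; lra|].
      apply Rmult_le_reg_r with (C1 + 1); [lra|]. unfold Rdiv.
      rewrite Rmult_assoc, Rinv_l by lra. lra. }
  assert (HR0 := Rabs_pos Rm).
  assert (Diff : Rabs (exp (A + Rm) - M) <=
    (C1 / v ^ S (S L) + C2) * (1 + y) ^ (J + S (S L)) * h ^ S L * exp (y / 4)).
  (* The split is [e^A (e^Rm - 1) + (e^A - M)], with [texp 0 Rm = 1]. *)
  { replace (exp (A + Rm) - M) with (exp A * (exp Rm - texp 0 Rm) + (exp A - M)).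
    2: { rewrite exp_plus. unfold texp, sumR; simpl. field. }
    assert (HhL : 0 < h ^ S L) by (apply pow_lt; lra).
    eapply Rle_trans; [apply Rabs_triang|].
    rewrite (Rmult_plus_distr_r _ C2), !Rmult_plus_distr_r. apply Rplus_le_compat.
    - rewrite Rabs_mult, (Rabs_right (exp A)) by (apply Rle_ge, Rlt_le, exp_pos).
      apply Rle_trans with (exp (y / 8) * (C1 / v ^ S (S L) * y ^ S (S L) * h ^ S L * exp (y / 8))).
      + apply Rmult_le_compat; [left; apply exp_pos|apply Rabs_pos| |].
        * apply exp_le. eapply Rle_trans; [apply Rle_abs|]. lra.
        * eapply Rle_trans; [apply texp_remainder|]. rewrite pow_1.
          apply Rmult_le_compat; [lra|left; apply exp_pos|exact HR1|apply exp_le, HR2].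
      + replace (exp (y / 4)) with (exp (y / 8) * exp (y / 8))
          by (rewrite <- exp_plus; f_equal; field).
        rewrite (Rmult_comm (exp (y / 8))), Rmult_assoc.
        apply Rmult_le_compat_r; [apply Rmult_le_pos; left; apply exp_pos|].
        apply Rmult_le_compat_r; [lra|]. apply Rmult_le_compat_l; [lra|].
        apply Rle_trans with ((1 + y) ^ S (S L)); [apply pow_incr; lra|].
        apply Rle_pow; [lra|lia].
    - eapply Rle_trans; [exact LB|].
      apply Rmult_le_compat; [|left; apply exp_pos| |apply exp_le; lra].
      + apply Rmult_le_pos; [|lra]. apply Rmult_le_pos; [lra|apply pow_le; lra].
      + apply Rmult_le_compat_r; [lra|]. apply Rmult_le_compat_l; [lra|].
        apply Rle_pow; [lra|lia]. }
  rewrite exp_plus, <- Rmult_minus_distr_l, Rabs_mult,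
    (Rabs_right (exp (- (y / 2)))) by (apply Rle_ge, Rlt_le, exp_pos).
  replace (exp (- (y / 4))) with (exp (- (y / 2)) * exp (y / 4))
    by (rewrite <- exp_plus; f_equal; field).
  replace (_ * (exp (- (y / 2)) * exp (y / 4))) with (exp (- (y / 2)) *
    ((C1 / v ^ S (S L) + C2) * (1 + y) ^ (J + S (S L)) * h ^ S L * exp (y / 4))) by ring.
  apply Rmult_le_compat_l; [left; apply exp_pos|exact Diff].
Qed.

(* Away from the origin, [1 <= (y h / (v d))^(L+1)] trades the Gaussian decay in
   [y = v n t^2] for the factor [n^-(L+1)]. *)
Lemma decay_far (a v d : R) (J L : nat) :
  0 < a -> 0 < v -> 0 < d ->
  exists C, 0 <= C /\ forall n t, (1 <= n)%nat -> d <= t ^ 2 ->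
    (1 + v * INR n * t ^ 2) ^ J * exp (- (a * (v * INR n * t ^ 2)))
    <= C * (/ INR n) ^ S L / (1 + v * INR n * t ^ 2).
Proof.
  intros Ha Hv Hd. destruct (poly_exp_decay a (J + S L) Ha) as [C [HC H]].
  assert (Hvd : 0 < v * d) by (apply Rmult_lt_0_compat; auto).
  assert (Hi : 0 < (/ (v * d)) ^ S L) by (apply pow_lt, Rinv_0_lt_compat, Hvd).
  exists (C * (/ (v * d)) ^ S L). split; [apply Rmult_le_pos; lra|].
  intros n t Hn Ht. assert (Hn0 : 0 < INR n) by (apply lt_0_INR; lia).
  set (y := v * INR n * t ^ 2).
  assert (Hy : 0 <= y) by (unfold y; apply Rmult_le_pos; [nra|apply pow2_ge_0]).
  set (h := / INR n). assert (Hh : 0 < h) by (apply Rinv_0_lt_compat, Hn0).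
  assert (One : 1 <= (/ (v * d)) ^ S L * h ^ S L * y ^ S L).
  { rewrite <- !Rpow_mult_distr. apply pow_R1_Rle.
    replace (/ (v * d) * h * y) with (t ^ 2 * / d) by (unfold h, y; field; lra).
    apply Rmult_le_reg_r with d; [lra|]. rewrite Rmult_assoc, Rinv_l; lra. }
  specialize (H y Hy). rewrite pow_add in H.
  assert (E0 := exp_pos (- (a * y))).
  assert (Hyp : y ^ S L <= (1 + y) ^ S L) by (apply pow_incr; lra).
  assert (HJ : 0 <= (1 + y) ^ J) by (apply pow_le; lra).
  assert (HhL : 0 < h ^ S L) by (apply pow_lt, Hh).
  apply Rle_trans with ((/ (v * d)) ^ S L * h ^ S L * ((1 + y) ^ J * (1 + y) ^ S L * exp (- (a * y)))).
  - rewrite <- (Rmult_1_l (_ * exp _)).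
    replace ((/ (v * d)) ^ S L * h ^ S L * ((1 + y) ^ J * (1 + y) ^ S L * exp (- (a * y))))
      with ((/ (v * d)) ^ S L * h ^ S L * (1 + y) ^ S L * ((1 + y) ^ J * exp (- (a * y)))) by ring.
    apply Rmult_le_compat_r; [apply Rmult_le_pos; lra|].
    eapply Rle_trans; [exact One|]. apply Rmult_le_compat_l; [apply Rmult_le_pos; lra|exact Hyp].
  - replace (C * (/ (v * d)) ^ S L * h ^ S L / (1 + y))
      with ((/ (v * d)) ^ S L * h ^ S L * (C / (1 + y))) by (unfold Rdiv; ring).
    apply Rmult_le_compat_l; [apply Rmult_le_pos; lra|exact H].
Qed.

Lemma gauss_far q L d :
  (1 <= q)%nat -> 0 < d ->
  exists C, 0 <= C /\ forall n t, (1 <= n)%nat -> d <= t ^ 2 ->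
    Rabs (exp (- (variance q * INR n * t ^ 2 / 2)) * edge_sum q L (variance q * INR n * t ^ 2) (/ INR n))
    <= C * (/ INR n) ^ S L / (1 + variance q * INR n * t ^ 2).
Proof.
  intros Hq Hd. assert (Hv := variance_pos q Hq).
  destruct (edge_sum_bounded q L) as [C1 [J [HC1 H1]]].
  destruct (decay_far (/ 2) (variance q) d J L) as [C2 [HC2 H2]]; try lra.
  exists (C1 * C2). split; [apply Rmult_le_pos; auto|]. intros n t Hn Ht.
  specialize (H2 n t Hn Ht). set (y := variance q * INR n * t ^ 2) in *.
  assert (Hy : 0 <= y).
  { unfold y; apply Rmult_le_pos; [|apply pow2_ge_0]. apply Rmult_le_pos; [lra|apply pos_INR]. }
  specialize (H1 y (/ INR n) Hy (inv_INR_bounds n Hn)).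
  rewrite Rabs_mult, (Rabs_right (exp _)) by (apply Rle_ge, Rlt_le, exp_pos).
  apply Rle_trans with (C1 * ((1 + y) ^ J * exp (- (/ 2 * y)))).
  - replace (/ 2 * y) with (y / 2) by field. rewrite <- Rmult_assoc, Rmult_comm.
    apply Rmult_le_compat_r; [left; apply exp_pos|exact H1].
  - unfold Rdiv in *. rewrite !Rmult_assoc in *. apply Rmult_le_compat_l; auto.
Qed.

(** Near 0, Gaussian decay trades the polynomial factor for [1/(1+y)]. Away from 0 no cancellation
    is exploited: the power of the kernel and the expansion are each small enough by themselves. *)
Lemma pointwise q L :
  (1 <= q)%nat ->
  exists C, 0 <= C /\ forall n t, (1 <= n)%nat -> Rabs t <= PI ->
    Rabs ((dirichlet q t / (1 + INR q)) ^ n -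
          exp (- (variance q * INR n * t ^ 2 / 2)) * edge_sum q L (variance q * INR n * t ^ 2) (/ INR n))
    <= C * (/ INR n) ^ S L / (1 + variance q * INR n * t ^ 2).
Proof.
  intros Hq. assert (Hv := variance_pos q Hq).
  destruct (pointwise_near q L Hq) as [C1 [J [d [HC1 [Hd H1]]]]].
  destruct (poly_exp_decay (/ 4) J) as [C2 [HC2 H2]]; [lra|].
  destruct (gauss_far q L d Hq Hd) as [C3 [HC3 H3]].
  (* In terms of [y], [e^(-n t^2/24)] is [e^(-y/(24 v))]; there is no polynomial factor, hence
     [J = 0]. *)
  destruct (decay_far (/ (24 * variance q)) (variance q) d 0 L) as [C4 [HC4 H4]]; auto.
  { apply Rinv_0_lt_compat; lra. }
  assert (HC12 : 0 <= C1 * C2) by (apply Rmult_le_pos; auto).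
  exists (C1 * C2 + C3 + C4). split; [lra|]. intros n t Hn Ht.
  specialize (H1 n t Hn). specialize (H3 n t Hn). specialize (H4 n t Hn).
  set (y := variance q * INR n * t ^ 2) in *. assert (Hn0 := pos_INR n).
  assert (Hy : 0 <= y).
  { unfold y; apply Rmult_le_pos; [|apply pow2_ge_0]. apply Rmult_le_pos; lra. }
  assert (Hh := inv_INR_bounds n Hn). set (h := / INR n) in *.
  assert (HhL : 0 < h ^ S L) by (apply pow_lt; lra).
  assert (Hy1 : 0 < / (1 + y)) by (apply Rinv_0_lt_compat; lra).
  assert (Hhy : 0 <= h ^ S L * / (1 + y)) by (apply Rmult_le_pos; lra).
  assert (P12 : 0 <= C1 * C2 * (h ^ S L * / (1 + y))) by (apply Rmult_le_pos; auto).
  assert (P3 : 0 <= C3 * (h ^ S L * / (1 + y))) by (apply Rmult_le_pos; auto).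
  assert (P4 : 0 <= C4 * (h ^ S L * / (1 + y))) by (apply Rmult_le_pos; auto).
  assert (Rw : forall c, c * h ^ S L / (1 + y) = c * (h ^ S L * / (1 + y)))
    by (intros; unfold Rdiv; ring).
  rewrite Rw in H3, H4 |- *.
  rewrite !Rmult_plus_distr_r.
  destruct (Rle_dec (t ^ 2) d) as [Near|Far].
  - specialize (H1 Near). specialize (H2 y Hy).
    eapply Rle_trans; [exact H1|].
    apply Rle_trans with (C1 * h ^ S L * ((1 + y) ^ J * exp (- (/ 4 * y)))).
    { right. replace (/ 4 * y) with (y / 4) by field. ring. }
    apply Rle_trans with (C1 * h ^ S L * (C2 / (1 + y))).
    { apply Rmult_le_compat_l; [apply Rmult_le_pos; lra|exact H2]. }
    unfold Rdiv. lra.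
  - assert (Far' : d <= t ^ 2) by lra. specialize (H3 Far'). specialize (H4 Far').
    unfold Rminus. eapply Rle_trans; [apply Rabs_triang|]. rewrite Rabs_Ropp.
    assert (D : Rabs ((dirichlet q t / (1 + INR q)) ^ n) <= exp (- (/ (24 * variance q) * y))).
    { rewrite <- RPow_abs.
      eapply Rle_trans; [apply pow_incr; split; [apply Rabs_pos|apply dirichlet_decay; auto]|].
      rewrite exp_pow. right; f_equal. unfold y; field; lra. }
    rewrite pow_O, Rmult_1_l in H4. lra.
Qed.

(** * Gaussian moments *)

Ltac solve_continuous :=
  intros; apply (ex_derive_continuous (V := R_NormedModule)); auto_derive; auto.

Lemma lim_pow_gauss (m : nat) : is_lim_seq (fun i => INR i ^ m * exp (- INR i ^ 2 / 2)) 0.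
Proof.
  destruct (poly_exp_decay (/ 2) m) as [C [HC H]]; [lra|].
  apply (is_lim_seq_le_le (fun _ => 0) _ (fun i => C * / INR (S i))).
  - intros i. assert (Hi := pos_INR i). split.
    + apply Rmult_le_pos; [apply pow_le, Hi|left; apply exp_pos].
    + replace (- INR i ^ 2 / 2) with (- (/ 2 * INR i ^ 2)) by field.
      (* This allows [poly_exp_decay] with [y = i^2] and compares [1/(1 + i^2)] with [1/(i + 1)]. *)
      assert (Hi2 : INR i <= INR i ^ 2).
      { destruct i; [simpl; lra|]. assert (1 <= INR (S i)) by (apply (le_INR 1); lia). nra. }
      apply Rle_trans with ((1 + INR i ^ 2) ^ m * exp (- (/ 2 * INR i ^ 2))).
      * apply Rmult_le_compat_r; [left; apply exp_pos|]. apply pow_incr; nra.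
      * eapply Rle_trans; [apply H; nra|]. apply Rmult_le_compat_l; [exact HC|].
        apply Rinv_le_contravar; [apply lt_0_INR; lia|]. rewrite S_INR; lra.
  - apply is_lim_seq_const.
  - replace (Finite 0) with (Rbar_mult C 0) by (simpl; f_equal; ring).
    apply is_lim_seq_scal_l. apply (is_lim_seq_incr_1 (fun n => / INR n)).
    replace (Finite 0) with (Rbar_inv p_infty) by reflexivity.
    apply is_lim_seq_inv; [apply is_lim_seq_INR|discriminate].
Qed.

Lemma is_derive_const_eq (f : R -> R) a b : (forall x, is_derive f x 0) -> f a = f b.
Proof.
  intros H. destruct (MVT_gen f a b (fun _ => 0)) as [c [_ E]].
  - intros; apply H.
  - intros x _. apply continuity_pt_filterlim.
    apply (ex_derive_continuous (V := R_NormedModule)); eexists; apply H.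
  - lra.
Qed.

(** * The Gaussian integral *)

Definition gauss_primitive (x : R) : R := RInt (fun t => exp (- t ^ 2 / 2)) 0 x.
(** Auxiliary integral of the classical real-variable evaluation: [gauss_primitive^2 + 2 gauss_aux]
    has zero derivative, and its value at 0 comes from the arctangent. *)
Definition gauss_aux (x : R) : R :=
  RInt (fun s => exp (- (x ^ 2 * (1 + s ^ 2)) / 2) / (1 + s ^ 2)) 0 1.

Lemma one_plus_sqr_pos s : 0 < 1 + s ^ 2.
Proof. assert (0 <= s ^ 2) by apply pow2_ge_0. lra. Qed.

Lemma is_derive_gauss_primitive x :
  is_derive gauss_primitive x (exp (- x ^ 2 / 2)).
Proof.
  apply (is_derive_RInt (fun t => exp (- t ^ 2 / 2)) gauss_primitive 0).
  - exists (mkposreal 1 Rlt_0_1). intros y _.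
    apply (RInt_correct (V := R_CompleteNormedModule)), ex_RInt_cont. solve_continuous.
  - solve_continuous.
Qed.

Lemma is_derive_gauss_aux x :
  is_derive gauss_aux x (- exp (- x ^ 2 / 2) * gauss_primitive x).
Proof.
  assert (Dz : forall u v, is_derive (fun z => exp (- (z ^ 2 * (1 + v ^ 2)) / 2) / (1 + v ^ 2)) u
                 (- u * exp (- (u ^ 2 * (1 + v ^ 2)) / 2))).
  { intros u v. assert (P := one_plus_sqr_pos v). auto_derive; auto.
    replace (u * (u * 1)) with (u ^ 2) by ring. replace (v * (v * 1)) with (v ^ 2) by ring.
    replace (- (u ^ 2 * (1 + v ^ 2)) * / 2) with (- (u ^ 2 * (1 + v ^ 2)) / 2) by reflexivity.
    field. lra. }
  assert (E : RInt (fun s => Derive (fun z => exp (- (z ^ 2 * (1 + s ^ 2)) / 2) / (1 + s ^ 2)) x) 0 1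
    = - exp (- x ^ 2 / 2) * gauss_primitive x).
  { rewrite (RInt_ext _ (fun s => - exp (- x ^ 2 / 2) * (x * exp (- (x * s + 0) ^ 2 / 2)))).
    (* The substitution [t = x s], in affine form, carries the integral over [[0, 1]] to
       [gauss_primitive x]. *)
    - assert (L := RInt_comp_lin (V := R_CompleteNormedModule)
        (fun t => exp (- t ^ 2 / 2)) x 0 0 1).
      rewrite Rmult_0_r, Rmult_1_r, !Rplus_0_r in L.
      unfold gauss_primitive. rewrite <- L by (apply ex_RInt_cont; solve_continuous).
      apply (RInt_scal (V := R_CompleteNormedModule) (fun s => x * exp (- (x * s + 0) ^ 2 / 2))).
      apply ex_RInt_cont; solve_continuous.
    - intros s _. etransitivity; [apply is_derive_unique, Dz|].
      replace (- (x ^ 2 * (1 + s ^ 2)) / 2) with (- x ^ 2 / 2 + - (x * s + 0) ^ 2 / 2) by field.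
      rewrite exp_plus. match goal with |- ?a = ?b => change (@eq R a b) end. ring. }
  rewrite <- E.
  apply (is_derive_RInt_param (fun x s => exp (- (x ^ 2 * (1 + s ^ 2)) / 2) / (1 + s ^ 2))).
  - exists (mkposreal 1 Rlt_0_1). intros y _ s _. eexists; apply Dz.
  - intros t _. apply (continuity_2d_pt_ext (fun u v => - u * exp (- (u ^ 2 * (1 + v ^ 2)) / 2))).
    + intros u v. symmetry. apply is_derive_unique, Dz.
    + apply continuity_2d_pt_mult.
      * apply continuity_2d_pt_opp, continuity_2d_pt_id1.
      * apply (continuity_1d_2d_pt_comp exp).
        { apply derivable_continuous_pt, derivable_pt_exp. }
        apply (continuity_2d_pt_ext (fun u v => - (u * u * (1 + v * v)) * / 2)).
        { intros; unfold Rdiv; simpl; ring. }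
        repeat (apply continuity_2d_pt_mult || apply continuity_2d_pt_opp ||
          apply continuity_2d_pt_plus || apply continuity_2d_pt_const ||
          apply continuity_2d_pt_id1 || apply continuity_2d_pt_id2).
  - exists (mkposreal 1 Rlt_0_1). intros y _. apply ex_RInt_cont.
    intros s. apply (ex_derive_continuous (V := R_NormedModule)).
    assert (P := one_plus_sqr_pos s). auto_derive. lra.
Qed.

Lemma gauss_primitive_sqr x : gauss_primitive x ^ 2 = PI / 2 - 2 * gauss_aux x.
Proof.
  assert (E := is_derive_const_eq (fun x => gauss_primitive x ^ 2 + 2 * gauss_aux x) x 0).
  assert (Z : gauss_aux 0 = PI / 4).
  { unfold gauss_aux. apply is_RInt_unique.
    apply (is_RInt_ext (fun s => / (1 + s ^ 2))).
    - intros s _. replace (- (0 ^ 2 * (1 + s ^ 2)) / 2) with 0 by field.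
      rewrite exp_0; unfold Rdiv; rewrite Rmult_1_l; reflexivity.
    - replace (PI / 4) with (minus (atan 1) (atan 0)).
      + apply (is_RInt_derive atan).
        * intros s _. assert (P := one_plus_sqr_pos s). auto_derive; auto. unfold Rsqr; field. lra.
        * intros s _. apply (ex_derive_continuous (V := R_NormedModule)).
          assert (P := one_plus_sqr_pos s). auto_derive. lra.
      + unfold minus, plus, opp; simpl. rewrite atan_1, atan_0; ring. }
  assert (Z' : gauss_primitive 0 = 0)
    by (apply (RInt_point (V := R_CompleteNormedModule) 0)).
  cbv beta in E. rewrite Z, Z' in E. rewrite <- (Rplus_0_r (gauss_primitive x ^ 2)).
  replace 0 with (2 * gauss_aux x - 2 * gauss_aux x) at 1 by ring.
  unfold Rminus at 1. rewrite <- Rplus_assoc, E; [field|].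
  clear x E; intros x.
  replace 0 with (2 * gauss_primitive x * exp (- x ^ 2 / 2) +
    2 * (- exp (- x ^ 2 / 2) * gauss_primitive x)) by ring.
  apply (is_derive_plus (fun x => gauss_primitive x ^ 2)).
  - evar_last; [apply is_derive_pow, is_derive_gauss_primitive|]. simpl; ring.
  - apply is_derive_scal, is_derive_gauss_aux.
Qed.

Lemma gauss_aux_bound x : 0 <= gauss_aux x <= exp (- x ^ 2 / 2).
Proof.
  assert (Ex : ex_RInt (fun s => exp (- (x ^ 2 * (1 + s ^ 2)) / 2) / (1 + s ^ 2)) 0 1).
  { apply ex_RInt_cont. intros s. apply (ex_derive_continuous (V := R_NormedModule)).
    assert (P := one_plus_sqr_pos s). auto_derive. lra. }
  assert (Cst : forall c, RInt (V := R_CompleteNormedModule) (fun _ => c) 0 1 = c :> R).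
  { intros c. rewrite RInt_const. unfold scal; simpl; unfold mult; simpl; ring. }
  assert (Hx : 0 <= x ^ 2) by apply pow2_ge_0.
  unfold gauss_aux; split.
  - apply RInt_ge_0; [lra|exact Ex|]. intros s _.
    apply Rdiv_le_0_compat; [left; apply exp_pos|apply one_plus_sqr_pos].
  - eapply Rle_trans; [|right; apply Cst]. apply RInt_le; [lra|exact Ex|apply ex_RInt_const|].
    intros s _. assert (P := one_plus_sqr_pos s). assert (0 <= s ^ 2) by apply pow2_ge_0.
    apply Rle_trans with (exp (- (x ^ 2 * (1 + s ^ 2)) / 2)).
    + rewrite <- Rmult_1_r. apply Rmult_le_compat_l; [left; apply exp_pos|].
      rewrite <- Rinv_1. apply Rinv_le_contravar; lra.
    + apply exp_le. nra.
Qed.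

(** Since [gauss_aux] vanishes at infinity, the half-line integrals tend to [sqrt (pi/2)]; evenness
    doubles them. *)
Lemma gauss_integral :
  is_lim_seq (fun i => RInt (fun t => exp (- t ^ 2 / 2)) (- INR i) (INR i)) (sqrt (2 * PI)).
Proof.
  assert (A : is_lim_seq (fun i => gauss_aux (INR i)) 0).
  { apply (is_lim_seq_le_le (fun _ => 0) _ (fun i => INR i ^ 0 * exp (- INR i ^ 2 / 2))).
    - intros i. rewrite pow_O, Rmult_1_l. apply gauss_aux_bound.
    - apply is_lim_seq_const.
    - apply (lim_pow_gauss 0). }
  assert (S4 : forall z, 0 <= z -> 2 * sqrt z = sqrt (4 * z)).
  { intros z Hz. rewrite sqrt_mult by lra. replace 4 with (2 * 2) by ring.
    rewrite sqrt_square by lra. reflexivity. }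
  assert (Ex : forall a b, ex_RInt (fun t => exp (- t ^ 2 / 2)) a b)
    by (intros; apply ex_RInt_cont; solve_continuous).
  assert (Z : gauss_primitive 0 = 0)
    by (apply (RInt_point (V := R_CompleteNormedModule) 0)).
  apply (is_lim_seq_ext (fun i => 2 * sqrt (PI / 2 - 2 * gauss_aux (INR i)))).
  - intros i. assert (Hi := pos_INR i). rewrite <- gauss_primitive_sqr, sqrt_pow2.
    + rewrite <- (RInt_Chasles (V := R_CompleteNormedModule) _ (- INR i) 0 (INR i)) by auto.
      rewrite <- (opp_RInt_swap (V := R_CompleteNormedModule)) by auto.
      fold (gauss_primitive (INR i)) (gauss_primitive (- INR i)).
      assert (O := is_derive_const_eq (fun x => gauss_primitive x + gauss_primitive (- x)) (INR i) 0).
      cbv beta in O. rewrite Ropp_0, Z in O.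
      unfold plus, opp; simpl. enough (gauss_primitive (INR i) + gauss_primitive (- INR i) = 0) by lra.
      rewrite O; [ring|]. intros x.
      replace 0 with (exp (- x ^ 2 / 2) + - (1) * exp (- (- x) ^ 2 / 2))
        by (replace ((- x) ^ 2) with (x ^ 2) by ring; ring).
      apply (is_derive_plus gauss_primitive (fun x => gauss_primitive (- x))).
      * apply is_derive_gauss_primitive.
      * apply (is_derive_comp gauss_primitive Ropp); [apply is_derive_gauss_primitive|].
        auto_derive; auto.
    + rewrite <- Z. unfold gauss_primitive. rewrite (RInt_point (V := R_CompleteNormedModule) 0).
      apply RInt_ge_0; auto. intros; left; apply exp_pos.
  - replace (sqrt (2 * PI)) with (2 * sqrt (PI / 2 - 2 * 0)).
    + apply (is_lim_seq_scal_l _ 2 (sqrt (PI / 2 - 2 * 0))).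
      apply (is_lim_seq_continuous sqrt).
      * apply continuity_pt_sqrt. assert (P := PI_RGT_0). lra.
      * apply is_lim_seq_minus'; [apply is_lim_seq_const|].
        apply (is_lim_seq_scal_l _ 2 0), A.
    + assert (P := PI_RGT_0). rewrite S4 by lra. f_equal; field.
Qed.

(** The [m]-th derivative of the Gaussian, given by the three-term Hermite recurrence because
    integration by parts yields the same recurrence for the moments. *)
Fixpoint gauss_deriv (m : nat) (x : R) : R :=
  match m with
  | O => exp (- x ^ 2 / 2)
  | S p => match p with
           | O => - x * exp (- x ^ 2 / 2)
           | S r => - x * gauss_deriv p x - INR p * gauss_deriv r x
           end
  end.

Lemma gauss_deriv_SS m x :
  gauss_deriv (S (S m)) x = - x * gauss_deriv (S m) x - INR (S m) * gauss_deriv m x.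
Proof. reflexivity. Qed.

Lemma is_derive_gauss_deriv m x : is_derive (gauss_deriv m) x (gauss_deriv (S m) x).
Proof.
  (* Two consecutive orders are carried, as the recurrence reaches two steps back. *)
  assert (H : forall m, (forall x, is_derive (gauss_deriv m) x (gauss_deriv (S m) x)) /\
     (forall x, is_derive (gauss_deriv (S m)) x (gauss_deriv (S (S m)) x))).
  2: apply H.
  clear m x; intros m; induction m as [|m [IH1 IH2]].
  - split; intros x.
    + unfold gauss_deriv. auto_derive; auto. unfold Rdiv; simpl; field.
    + rewrite gauss_deriv_SS. unfold gauss_deriv. auto_derive; auto. unfold Rdiv; simpl; field.
  - split; [exact IH2|]. intros x.
    apply (is_derive_ext (fun x => - x * gauss_deriv (S m) x - INR (S m) * gauss_deriv m x)).
    { intros; symmetry; apply gauss_deriv_SS. }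
    rewrite (gauss_deriv_SS (S m)).
    replace (- x * gauss_deriv (S (S m)) x - INR (S (S m)) * gauss_deriv (S m) x) with
      ((- (1) * gauss_deriv (S m) x + - x * gauss_deriv (S (S m)) x) -
        INR (S m) * gauss_deriv (S m) x) by (rewrite (S_INR (S m)); ring).
    apply (is_derive_minus (fun x => - x * gauss_deriv (S m) x)
             (fun x => INR (S m) * gauss_deriv m x)).
    + apply (is_derive_mult Ropp (gauss_deriv (S m))); auto.
      * auto_derive; auto.
      * intros; apply Rmult_comm.
    + apply is_derive_scal; auto.
Qed.

Lemma hermite_gauss_deriv m x :
  exp (- x ^ 2 / 2) * hermite m x = (-1) ^ m * gauss_deriv m x.
Proof.
  assert (D : forall x, Derive_n (fun t => exp (- t ^ 2 / 2)) m x = gauss_deriv m x).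
  { clear x; induction m as [|m IH]; intros x; [reflexivity|].
    simpl Derive_n. rewrite (Derive_ext _ _ _ IH).
    apply is_derive_unique, is_derive_gauss_deriv. }
  unfold hermite. rewrite D.
  replace (_ * (_ * _ * _)) with (exp (- x ^ 2 / 2) * exp (x ^ 2 / 2) * ((-1) ^ m * gauss_deriv m x))
    by ring.
  rewrite <- exp_plus. replace (- x ^ 2 / 2 + x ^ 2 / 2) with 0 by field. rewrite exp_0; ring.
Qed.

(** The [m]-th derivative in [x] of [e^(-t^2/2) cos (t x)]; the phase [m pi/2] treats sines and
    cosines uniformly. *)
Definition moment_fun (m : nat) (x t : R) : R :=
  exp (- t ^ 2 / 2) * t ^ m * cos (t * x + INR m * (PI / 2)).

Lemma continuous_moment_fun m x t : continuous (moment_fun m x) t.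
Proof. unfold moment_fun. generalize (INR m * (PI / 2)). solve_continuous. Qed.

(** Equal to [e^(-t^2/2) t^m sin (t x + m pi/2)], the function whose derivative encodes the
    integration by parts. *)
Definition boundary (m : nat) (x t : R) : R :=
  - (exp (- t ^ 2 / 2) * t ^ m * cos (t * x + INR (S m) * (PI / 2))).

Lemma cos_quarter A m : cos (A + INR (S m) * (PI / 2)) = - sin (A + INR m * (PI / 2)).
Proof.
  rewrite S_INR. replace (A + (INR m + 1) * (PI / 2)) with (PI / 2 + (A + INR m * (PI / 2))) by ring.
  rewrite cos_plus, cos_PI2, sin_PI2; ring.
Qed.

Lemma sin_quarter A m : sin (A + INR (S m) * (PI / 2)) = cos (A + INR m * (PI / 2)).
Proof.
  rewrite S_INR. replace (A + (INR m + 1) * (PI / 2)) with (PI / 2 + (A + INR m * (PI / 2))) by ring.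
  rewrite sin_plus, cos_PI2, sin_PI2; ring.
Qed.

Lemma is_derive_boundary m x t :
  is_derive (boundary m x) t (moment_fun (S m) x t + x * moment_fun m x t +
    match m with O => 0 | S p => INR m * moment_fun p x t end).
Proof.
  unfold boundary, moment_fun.
  set (c := INR (S m) * (PI / 2)).
  assert (D : is_derive (fun t => - (exp (- t ^ 2 / 2) * t ^ m * cos (t * x + c))) t
    (t * exp (- t ^ 2 / 2) * t ^ m * cos (t * x + c)
     - exp (- t ^ 2 / 2) * (INR m * t ^ Nat.pred m) * cos (t * x + c)
     + exp (- t ^ 2 / 2) * t ^ m * (x * sin (t * x + c)))).
  { auto_derive; auto. unfold Rdiv. simpl. field. }
  evar_last; [exact D|]. unfold c. rewrite sin_quarter.
  destruct m as [|p].
  - simpl. ring.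
  - cbn [Nat.pred]. rewrite !(cos_quarter _ (S p)), (sin_quarter _ p).
    rewrite <- (tech_pow_Rmult t (S p)). ring.
Qed.

Lemma moment_recursion m x T :
  RInt (moment_fun (S m) x) (- T) T =
  boundary m x T - boundary m x (- T) - x * RInt (moment_fun m x) (- T) T
  - match m with O => 0 | S p => INR m * RInt (moment_fun p x) (- T) T end.
Proof.
  assert (Ex : forall m a b, ex_RInt (moment_fun m x) a b)
    by (intros; apply ex_RInt_cont, continuous_moment_fun).
  assert (I1 := is_RInt_derive (V := R_CompleteNormedModule) (boundary m x) _ (- T) T
     (fun t _ => is_derive_boundary m x t)).
  apply (is_RInt_unique (V := R_CompleteNormedModule)) in I1.
  2: { intros t _. repeat apply (continuous_plus (V := R_NormedModule)).
       - apply continuous_moment_fun.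
       - apply (continuous_scal_r x (moment_fun m x)), continuous_moment_fun.
       - destruct m as [|p]; [apply continuous_const|].
         apply (continuous_scal_r (INR (S p)) (moment_fun p x)), continuous_moment_fun. }
  assert (I2 : is_RInt (fun t => moment_fun (S m) x t + x * moment_fun m x t +
      match m with O => 0 | S p => INR m * moment_fun p x t end) (- T) T
    (RInt (moment_fun (S m) x) (- T) T + x * RInt (moment_fun m x) (- T) T +
      match m with O => 0 | S p => INR m * RInt (moment_fun p x) (- T) T end)).
  { assert (Is : forall m, is_RInt (moment_fun m x) (- T) T (RInt (moment_fun m x) (- T) T))
      by (intros; apply (RInt_correct (V := R_CompleteNormedModule)); auto).
    apply (is_RInt_plus (V := R_NormedModule)
      (fun t => moment_fun (S m) x t + x * moment_fun m x t)).
    - apply (is_RInt_plus (V := R_NormedModule)); [apply Is|].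
      apply (is_RInt_scal (V := R_NormedModule)), Is.
    - destruct m as [|p].
      + evar_last; [apply (is_RInt_const (V := R_NormedModule))|].
        unfold scal; simpl; unfold mult; simpl; ring.
      + apply (is_RInt_scal (V := R_NormedModule)), Is. }
  apply (is_RInt_unique (V := R_CompleteNormedModule)) in I2.
  rewrite I2 in I1. unfold minus, plus, opp in I1; simpl in I1.
  simpl. destruct m; lra.
Qed.

Lemma lim_boundary m x : is_lim_seq (fun i => boundary m x (INR i) - boundary m x (- INR i)) 0.
Proof.
  apply (is_lim_seq_abs_0 (fun i => boundary m x (INR i) - boundary m x (- INR i))).
  assert (Bd : forall t, 0 <= t -> forall s, s = t \/ s = - t ->
     Rabs (boundary m x s) <= t ^ m * exp (- t ^ 2 / 2)).
  { intros t Ht s Hs. unfold boundary. rewrite Rabs_Ropp, !Rabs_mult.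
    assert (C : Rabs (cos (s * x + INR (S m) * (PI / 2))) <= 1)
      by (apply Rabs_le, COS_bound).
    rewrite (Rabs_right (exp _)) by (apply Rle_ge, Rlt_le, exp_pos).
    assert (A : Rabs s = t).
    { destruct Hs as [->| ->]; [|rewrite Rabs_Ropp]; apply Rabs_right; lra. }
    rewrite <- RPow_abs, A.
    replace (- s ^ 2 / 2) with (- t ^ 2 / 2) by (destruct Hs as [->| ->]; field).
    assert (0 <= t ^ m * exp (- t ^ 2 / 2))
      by (apply Rmult_le_pos; [apply pow_le, Ht|left; apply exp_pos]).
    rewrite (Rmult_comm (exp _)). nra. }
  apply (is_lim_seq_le_le (fun _ => 0) _ (fun i => 2 * (INR i ^ m * exp (- INR i ^ 2 / 2)))).
  - intros i. split; [apply Rabs_pos|]. assert (Hi := pos_INR i).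
    assert (B1 := Bd _ Hi (INR i) (or_introl eq_refl)).
    assert (B2 := Bd _ Hi (- INR i) (or_intror eq_refl)).
    unfold Rminus. eapply Rle_trans; [apply Rabs_triang|]. rewrite Rabs_Ropp. lra.
  - apply is_lim_seq_const.
  - replace (Finite 0) with (Rbar_mult 2 0) by (simpl; f_equal; ring).
    apply is_lim_seq_scal_l, lim_pow_gauss.
Qed.

Lemma is_derive_moment_0 T x :
  is_derive (fun x => RInt (moment_fun 0 x) (- T) T) x (RInt (moment_fun 1 x) (- T) T).
Proof.
  assert (Dz : forall u t, is_derive (fun z => moment_fun 0 z t) u (moment_fun 1 u t)).
  { intros u t. unfold moment_fun. rewrite cos_quarter.
    generalize (INR 0 * (PI / 2)). intros c. auto_derive; auto. unfold Rdiv; simpl; field. }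
  evar_last.
  - apply (is_derive_RInt_param (fun x t => moment_fun 0 x t)).
    + exists (mkposreal 1 Rlt_0_1). intros y _ t _. eexists; apply Dz.
    + intros t _. apply (continuity_2d_pt_ext (fun u v => moment_fun 1 u v)).
      * intros u v. symmetry. apply is_derive_unique, Dz.
      * unfold moment_fun. generalize (INR 1 * (PI / 2)); intros c.
        apply continuity_2d_pt_mult; [apply continuity_2d_pt_mult|].
        { apply (continuity_1d_2d_pt_comp exp (fun _ v => - v ^ 2 / 2)).
          { apply derivable_continuous_pt, derivable_pt_exp. }
          apply (continuity_2d_pt_ext (fun u v => - (v * v) * / 2)).
          { intros; unfold Rdiv; simpl; ring. }
          repeat (apply continuity_2d_pt_mult || apply continuity_2d_pt_opp ||
            apply continuity_2d_pt_const || apply continuity_2d_pt_id2). }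
        { apply (continuity_2d_pt_ext (fun u v => v)); [intros; simpl; ring|].
          apply continuity_2d_pt_id2. }
        apply (continuity_1d_2d_pt_comp cos (fun u v => v * u + c)).
        { apply continuity_cos. }
        repeat (apply continuity_2d_pt_mult || apply continuity_2d_pt_plus ||
          apply continuity_2d_pt_const || apply continuity_2d_pt_id1 || apply continuity_2d_pt_id2).
    + exists (mkposreal 1 Rlt_0_1). intros y _. apply ex_RInt_cont, continuous_moment_fun.
  - apply RInt_ext. intros t _. apply is_derive_unique, Dz.
Qed.

(* [x |-> e^(x^2/2) int_(-T)^T e^(-t^2/2) cos (t x) dt] has a derivative of order
   [e^(-T^2/2)], hence becomes constant as [T] grows. *)
Lemma lim_moment_0 x :
  is_lim_seq (fun i => RInt (moment_fun 0 x) (- INR i) (INR i)) (sqrt (2 * PI) * exp (- x ^ 2 / 2)).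
Proof.
  set (N := fun i x => RInt (moment_fun 0 x) (- INR i) (INR i)).
  assert (L0 : is_lim_seq (fun i => N i 0) (sqrt (2 * PI))).
  { apply (is_lim_seq_ext (fun i => RInt (fun t => exp (- t ^ 2 / 2)) (- INR i) (INR i))).
    - intros i. apply RInt_ext. intros t _. unfold moment_fun.
      rewrite Rmult_0_r, pow_O, Rmult_0_l, Rplus_0_l, cos_0, !Rmult_1_r. reflexivity.
    - apply gauss_integral. }
  set (f := fun i x => N i x * exp (x ^ 2 / 2)).
  assert (Dif : forall i, Rabs (f i x - N i 0) <=
     Rabs x * (2 * exp (x ^ 2 / 2)) * (INR i ^ 0 * exp (- INR i ^ 2 / 2))).
  { intros i. set (T := INR i).
    (* By [moment_recursion] the derivative of [N] is the boundary difference minus [x N]; the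
       factor [e^(x^2/2)] cancels the second part. *)
    assert (Hf : forall u, is_derive (fun x => f i x - N i 0) u
       ((boundary 0 u T - boundary 0 u (- T)) * exp (u ^ 2 / 2))).
    { intros u. evar_last.
      - apply (is_derive_minus (fun x => f i x) (fun _ => N i 0)).
        + apply (is_derive_mult (N i) (fun x => exp (x ^ 2 / 2))).
          * apply is_derive_moment_0.
          * instantiate (1 := u * exp (u ^ 2 / 2)). auto_derive; auto. unfold Rdiv; simpl; field.
          * intros; apply Rmult_comm.
        + apply is_derive_const.
      - fold T. rewrite moment_recursion. change (RInt (moment_fun 0 u) (- T) T) with (N i u).
        unfold minus, plus, opp, zero, mult; simpl. unfold mult; simpl. ring. }
    assert (M := MVT_from_0 (fun x => f i x - N i 0) _
      (2 * exp (x ^ 2 / 2) * (INR i ^ 0 * exp (- INR i ^ 2 / 2))) x Hf).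
    rewrite (Rmult_assoc (Rabs x)). apply M.
    - unfold f. replace (0 ^ 2 / 2) with 0 by field. rewrite exp_0; ring.
    - intros u Hu. fold T. rewrite Rabs_mult, (Rabs_right (exp (u ^ 2 / 2)))
        by (apply Rle_ge, Rlt_le, exp_pos).
      replace (2 * exp (x ^ 2 / 2) * (T ^ 0 * exp (- T ^ 2 / 2)))
        with (2 * exp (- T ^ 2 / 2) * exp (x ^ 2 / 2)) by (simpl; ring).
      apply Rmult_le_compat; [apply Rabs_pos|left; apply exp_pos| |].
      + assert (Bd : forall s, s ^ 2 = T ^ 2 -> Rabs (boundary 0 u s) <= exp (- T ^ 2 / 2)).
        { intros s Hs. unfold boundary. rewrite Rabs_Ropp, !Rabs_mult, Hs, pow_O, Rabs_R1, Rmult_1_r.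
          rewrite (Rabs_right (exp _)) by (apply Rle_ge, Rlt_le, exp_pos).
          rewrite <- (Rmult_1_r (exp _)) at 2. apply Rmult_le_compat_l; [left; apply exp_pos|].
          apply Rabs_le, COS_bound. }
        assert (B1 := Bd T eq_refl). assert (B2 := Bd (- T) ltac:(ring)).
        unfold Rminus. eapply Rle_trans; [apply Rabs_triang|]. rewrite Rabs_Ropp. lra.
      + apply exp_le. apply Rmult_le_compat_r; [lra|].
        rewrite <- (pow2_abs u), <- (pow2_abs x). apply pow_incr; split; [apply Rabs_pos|exact Hu]. }
  apply (is_lim_seq_ext (fun i => (N i 0 + (f i x - N i 0)) * exp (- x ^ 2 / 2))).
  { intros i. unfold f. replace (N i 0 + (N i x * exp (x ^ 2 / 2) - N i 0)) with
      (N i x * exp (x ^ 2 / 2)) by ring.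
    rewrite Rmult_assoc, <- exp_plus. replace (x ^ 2 / 2 + - x ^ 2 / 2) with 0 by field.
    rewrite exp_0, Rmult_1_r; reflexivity. }
  replace (sqrt (2 * PI)) with (sqrt (2 * PI) + 0) by ring.
  apply (is_lim_seq_scal_r _ (exp (- x ^ 2 / 2)) (sqrt (2 * PI) + 0)).
  apply is_lim_seq_plus'; [exact L0|].
  apply (is_lim_seq_abs_0 (fun i => f i x - N i 0)).
  apply (is_lim_seq_le_le (fun _ => 0) _ (fun i =>
     Rabs x * (2 * exp (x ^ 2 / 2)) * (INR i ^ 0 * exp (- INR i ^ 2 / 2)))).
  - intros i; split; [apply Rabs_pos|apply Dif].
  - apply is_lim_seq_const.
  - replace (Finite 0) with (Rbar_mult (Rabs x * (2 * exp (x ^ 2 / 2))) 0) by (simpl; f_equal; ring).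
    apply is_lim_seq_scal_l, lim_pow_gauss.
Qed.

(** The boundary terms disappear and leave the recurrence of [gauss_deriv]; being of second order,
    it calls for strong induction with separate cases 0 and 1. *)
Lemma lim_moment m x :
  is_lim_seq (fun i => RInt (moment_fun m x) (- INR i) (INR i)) (sqrt (2 * PI) * gauss_deriv m x).
Proof.
  induction m as [m IH] using (well_founded_induction lt_wf).
  destruct m as [|[|m]].
  - apply lim_moment_0.
  - apply (is_lim_seq_ext (fun i => (boundary 0 x (INR i) - boundary 0 x (- INR i))
      - x * RInt (moment_fun 0 x) (- INR i) (INR i))).
    + intros i. rewrite moment_recursion; ring.
    + replace (sqrt (2 * PI) * gauss_deriv 1 x) with
        (0 - x * (sqrt (2 * PI) * gauss_deriv 0 x)) by (simpl; ring).
      apply is_lim_seq_minus'; [apply lim_boundary|].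
      apply (is_lim_seq_scal_l _ x (sqrt (2 * PI) * gauss_deriv 0 x)), lim_moment_0.
  - apply (is_lim_seq_ext (fun i => (boundary (S m) x (INR i) - boundary (S m) x (- INR i))
      - x * RInt (moment_fun (S m) x) (- INR i) (INR i)
      - INR (S m) * RInt (moment_fun m x) (- INR i) (INR i))).
    + intros i. rewrite (moment_recursion (S m)); reflexivity.
    + replace (sqrt (2 * PI) * gauss_deriv (S (S m)) x) with
        (0 - x * (sqrt (2 * PI) * gauss_deriv (S m) x) -
          INR (S m) * (sqrt (2 * PI) * gauss_deriv m x)) by (rewrite gauss_deriv_SS; ring).
      apply is_lim_seq_minus'; [apply is_lim_seq_minus'|].
      * apply lim_boundary.
      * apply (is_lim_seq_scal_l _ x (sqrt (2 * PI) * gauss_deriv (S m) x)), IH; lia.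
      * apply (is_lim_seq_scal_l _ (INR (S m)) (sqrt (2 * PI) * gauss_deriv m x)), IH; lia.
Qed.

Lemma lim_even_moment j x :
  is_lim_seq (fun i => RInt (fun t => exp (- t ^ 2 / 2) * t ^ (2 * j) * cos (t * x)) (- INR i) (INR i))
    (sqrt (2 * PI) * ((-1) ^ j * (exp (- x ^ 2 / 2) * hermite (2 * j) x))).
Proof.
  rewrite hermite_gauss_deriv, pow_1_even, Rmult_1_l.
  (* An even order [2j] turns the phase by [j pi], which contributes only [(-1)^j]. *)
  assert (Cs : forall A, cos (A + INR (2 * j) * (PI / 2)) = (-1) ^ j * cos A).
  { intros A. induction j as [|j IH]; [simpl; f_equal; rewrite Rmult_0_l, Rplus_0_r; ring|].
    replace (2 * S j)%nat with (S (S (2 * j))) by lia.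
    rewrite cos_quarter, sin_quarter, IH. simpl; ring. }
  assert (S2 : (-1) ^ j * (-1) ^ j = 1).
  { rewrite <- Rpow_mult_distr. replace (-1 * -1) with 1 by ring. apply pow1. }
  apply (is_lim_seq_ext (fun i => (-1) ^ j * RInt (moment_fun (2 * j) x) (- INR i) (INR i))).
  - intros i. rewrite <- (RInt_scal (V := R_CompleteNormedModule) (moment_fun (2 * j) x))
      by (apply ex_RInt_cont, continuous_moment_fun).
    apply RInt_ext. intros t _. unfold moment_fun. rewrite Cs.
    unfold scal; simpl; unfold mult; simpl.
    replace (_ * (_ * _ * (_ * _))) with ((-1) ^ j * (-1) ^ j *
      (exp (- t ^ 2 / 2) * t ^ (2 * j) * cos (t * x))) by (simpl; ring).
    rewrite S2, Rmult_1_l; reflexivity.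
  - replace (sqrt (2 * PI) * ((-1) ^ j * gauss_deriv (2 * j) x)) with
      ((-1) ^ j * (sqrt (2 * PI) * gauss_deriv (2 * j) x)) by ring.
    apply (is_lim_seq_scal_l _ ((-1) ^ j) (sqrt (2 * PI) * gauss_deriv (2 * j) x)), lim_moment.
Qed.

(** * Integration of the pointwise bounds *)

Lemma tuples_length len b l : In l (tuples len b) -> length l = len.
Proof.
  revert l; induction len as [|len IH]; intros l H.
  - destruct H as [<-|[]]; reflexivity.
  - change (tuples (S len) b) with
      (flat_map (fun a => map (cons a) (tuples len b)) (seq 0 (S b))) in H.
    apply in_flat_map in H as [a [_ H]]. apply in_map_iff in H as [l' [<- H]].
    simpl; f_equal; auto.
Qed.

Lemma weight_wt l : weight l = wt 1 l.
Proof.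
  (* Generalised to an arbitrary first index, for induction on the list. *)
  assert (H : forall m l, sumN (map (fun i => (m + i) * nth i l 0)%nat (seq 0 (length l))) = wt m l).
  2: exact (H 1%nat l).
  clear l; intros m l; revert m; induction l as [|k l IH]; intros m; [reflexivity|].
  simpl length. simpl seq. rewrite <- seq_shift. cbn [map]. rewrite map_map.
  cbn [wt]. rewrite <- IH.
  change (sumN (?a :: ?r)) with (a + sumN r)%nat. cbn [nth].
  f_equal; [lia|]. f_equal. apply map_ext; intros i. f_equal; lia.
Qed.

(** Twice the cumulant of order [2m + 2] of the uniform law, divided by [(2m+2)!]. *)
Definition cum_coef (q m : nat) : R :=
  bernoulli (2 * (m + 1)) * ((INR q + 1) ^ (2 * m + 2) - 1) / (INR (fact (2 * m + 2)) * INR (m + 1)).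

(** Dividing by [v^(m+1)] gives [(12/Q)^(m+1)]; [kappa] has [2(m+1)] in the denominator where
    [cum_coef] has [m + 1], so one 12 becomes 6. This is the origin of [(6/Q)^s]. *)
Lemma edge_coef_cum q m :
  (1 <= q)%nat ->
  edge_coef q m = (-1) ^ S m * ((12 / (INR q * (INR q + 2))) ^ m * (6 / (INR q * (INR q + 2))) *
    cum_coef q m).
Proof.
  intros Hq. assert (Hv := variance_pos q Hq). unfold variance in Hv.
  assert (0 < INR q * (INR q + 2)) by lra.
  unfold edge_coef, kappa, cum_coef, beta, variance.
  replace (2 * S m)%nat with (2 * m + 2)%nat by lia.
  replace (2 * (m + 1))%nat with (2 * m + 2)%nat by lia.
  replace (INR (2 * m + 2)) with (2 * INR (m + 1))
    by (rewrite !plus_INR, mult_INR; simpl; ring).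
  set (Q := INR q * (INR q + 2)) in *.
  set (c := (Q / 12) ^ S m).
  assert (Hc : / c = (12 / Q) ^ m * (12 / Q)).
  { unfold c. rewrite <- pow_inv. replace (/ (Q / 12)) with (12 / Q) by (field; lra). simpl; ring. }
  unfold Rdiv at 1. rewrite Hc. generalize ((12 / Q) ^ m). intros z. field.
  repeat split; try apply INR_fact_neq_0; try (apply not_0_INR; lia); lra.
Qed.

(** Powers are collected over a tuple. For weight [nu] and [s] parts the sign is [(-1)^(nu+s)], the
    same as that of the Gaussian moment of order [2(nu+s)]. *)
Lemma term_cum q m l :
  (1 <= q)%nat ->
  term (edge_coef q) m l = (-1) ^ (wt m l + sumN l) *
    ((12 / (INR q * (INR q + 2))) ^ wt m l * (6 / (INR q * (INR q + 2))) ^ sumN l *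
     prodR (map (fun i => / INR (fact (nth (i - m) l 0%nat)) * cum_coef q i ^ nth (i - m) l 0%nat)
       (seq m (length l)))).
Proof.
  intros Hq. revert m; induction l as [|k l IH]; intros m.
  - unfold prodR; simpl; ring.
  - cbn [term wt length seq map]. rewrite IH.
    change (sumN (k :: l)) with (k + sumN l)%nat.
    rewrite (map_ext_in (fun i => / INR (fact (nth (i - m) (k :: l) 0%nat)) *
        cum_coef q i ^ nth (i - m) (k :: l) 0%nat)
      (fun i => / INR (fact (nth (i - S m) l 0%nat)) * cum_coef q i ^ nth (i - S m) l 0%nat)).
    2: { intros i Hi. apply in_seq in Hi.
         replace (i - m)%nat with (S (i - S m)) by lia. reflexivity. }
    set (P := map _ (seq (S m) (length l))).
    change (prodR (?a :: P)) with (a * prodR P).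
    rewrite Nat.sub_diag. cbn [nth].
    rewrite edge_coef_cum, !Rpow_mult_distr, <- !pow_mult by assumption.
    replace (m * k + wt (S m) l + (k + sumN l))%nat
      with (S m * k + (wt (S m) l + sumN l))%nat by lia.
    rewrite (pow_add (-1) (S m * k)), (pow_add _ (m * k)), (pow_add _ k (sumN l)).
    unfold Rdiv at 1. ring.
Qed.

Lemma is_lim_seq_sumR {A} (u : A -> nat -> R) (v : A -> R) l :
  (forall a, In a l -> is_lim_seq (u a) (v a)) ->
  is_lim_seq (fun i => sumR (map (fun a => u a i) l)) (sumR (map v l)).
Proof.
  intros H; induction l as [|a l IH].
  - apply is_lim_seq_const.
  - apply (is_lim_seq_plus' (u a)); [apply H; left; auto|].
    apply IH; intros; apply H; right; auto.
Qed.

Lemma continuous_monomial_cos c k x t :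
  continuous (fun t => c * (exp (- t ^ 2 / 2) * t ^ k * cos (t * x))) t.
Proof. solve_continuous. Qed.

Lemma edge_poly_compositions q nu t :
  edge_poly (edge_coef q) nu (t ^ 2) =
  sumR (map (fun l => term (edge_coef q) 1 l * t ^ (2 * (nu + sumN l))) (compositions nu)).
Proof.
  unfold edge_poly, wsum, compositions. rewrite sumR_filter.
  apply sumR_ext; intros l _. rewrite weight_wt.
  destruct (Nat.eqb_spec (wt 1 l) nu) as [Hw|]; [|reflexivity].
  rewrite term_monomial, <- pow_mult, Hw. reflexivity.
Qed.

Lemma edge_integrand q nu x t :
  exp (- t ^ 2 / 2) * edge_poly (edge_coef q) nu (t ^ 2) * cos (t * x) =
  sumR (map (fun l => term (edge_coef q) 1 l *
    (exp (- t ^ 2 / 2) * t ^ (2 * (nu + sumN l)) * cos (t * x))) (compositions nu)).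
Proof.
  rewrite edge_poly_compositions.
  rewrite (Rmult_comm (exp _)), Rmult_assoc, Rmult_comm, <- sumR_scal.
  apply sumR_ext; intros l _. ring.
Qed.

Lemma lim_edge_poly q nu x :
  (1 <= q)%nat ->
  is_lim_seq (fun i => RInt (fun t => exp (- t ^ 2 / 2) * edge_poly (edge_coef q) nu (t ^ 2) *
      cos (t * x)) (- INR i) (INR i))
    (2 * PI * qcoef q nu x).
Proof.
  intros Hq. assert (HP := PI_RGT_0).
  assert (Hs : sqrt (2 * PI) * sqrt (2 * PI) = 2 * PI) by (apply sqrt_sqrt; lra).
  assert (Hs0 : 0 < sqrt (2 * PI)) by (apply sqrt_lt_R0; lra).
  apply (is_lim_seq_ext (fun i => sumR (map (fun l => term (edge_coef q) 1 l *
      RInt (fun t => exp (- t ^ 2 / 2) * t ^ (2 * (nu + sumN l)) * cos (t * x)) (- INR i) (INR i))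
    (compositions nu)))).
  { intros i. rewrite (RInt_ext _ _ _ _ (fun t _ => edge_integrand q nu x t)).
    rewrite (RInt_sumR (fun l t => term (edge_coef q) 1 l *
      (exp (- t ^ 2 / 2) * t ^ (2 * (nu + sumN l)) * cos (t * x))))
      by (intros; apply continuous_monomial_cos).
    apply sumR_ext; intros l _. symmetry.
    apply (RInt_scal (V := R_CompleteNormedModule)
      (fun t => exp (- t ^ 2 / 2) * t ^ (2 * (nu + sumN l)) * cos (t * x))).
    apply ex_RInt_cont. solve_continuous. }
  replace (2 * PI * qcoef q nu x) with (sumR (map (fun l => term (edge_coef q) 1 l *
    (sqrt (2 * PI) * ((-1) ^ (nu + sumN l) *
      (exp (- x ^ 2 / 2) * hermite (2 * (nu + sumN l)) x)))) (compositions nu))).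
  - apply (is_lim_seq_sumR (fun l i => term (edge_coef q) 1 l *
      RInt (fun t => exp (- t ^ 2 / 2) * t ^ (2 * (nu + sumN l)) * cos (t * x)) (- INR i) (INR i))).
    intros l _. apply (is_lim_seq_scal_l _ (term (edge_coef q) 1 l)
      (sqrt (2 * PI) * ((-1) ^ (nu + sumN l) *
      (exp (- x ^ 2 / 2) * hermite (2 * (nu + sumN l)) x)))). apply lim_even_moment.
  (* Writing [2 pi] as the square of its root leaves one root after the normalisation in [qcoef]. *)
  - unfold qcoef. set (r := sqrt (2 * PI)) in *. rewrite <- Hs.
    set (Q := INR q * (INR q + 2)).
    match goal with |- _ = ?a * (?b * ?c * ?d * sumR ?e) =>
      replace (a * (b * c * d * sumR e)) with (r * c * d * sumR e) by (field; lra) end.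
    rewrite <- sumR_scal. apply sumR_ext; intros l Hl.
    unfold compositions in Hl. apply filter_In in Hl as [Hl Hw].
    apply Nat.eqb_eq in Hw. rewrite weight_wt in Hw. apply tuples_length in Hl.
    rewrite (term_cum q 1 l Hq), Hw, Hl. fold Q.
    change (fun m => / INR (fact (nth (m - 1) l 0%nat)) * _) with
      (fun i => / INR (fact (nth (i - 1) l 0%nat)) * cum_coef q i ^ nth (i - 1) l 0%nat).
    set (Pr := prodR _).
    (* The sign of the coefficient cancels the sign of the even moment. *)
    assert (S2 : (-1) ^ (nu + sumN l) * (-1) ^ (nu + sumN l) = 1).
    { rewrite <- Rpow_mult_distr. replace (-1 * -1) with 1 by ring. apply pow1. }
    match goal with |- ?lhs = _ => replace lhs with
      ((-1) ^ (nu + sumN l) * (-1) ^ (nu + sumN l) * ((12 / Q) ^ nu * (6 / Q) ^ sumN l * Pr *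
       (r * (exp (- x ^ 2 / 2) * hermite (2 * (nu + sumN l)) x)))) by ring end.
    rewrite S2. ring.
Qed.

Lemma continuous_edge_poly q nu x t :
  continuous (fun t => exp (- t ^ 2 / 2) * edge_poly (edge_coef q) nu (t ^ 2) * cos (t * x)) t.
Proof.
  apply (continuous_ext (fun t => sumR (map (fun l => term (edge_coef q) 1 l *
    (exp (- t ^ 2 / 2) * t ^ (2 * (nu + sumN l)) * cos (t * x))) (compositions nu)))).
  - intros s; symmetry; apply edge_integrand.
  - apply (continuous_sumR (fun l t => term (edge_coef q) 1 l *
      (exp (- t ^ 2 / 2) * t ^ (2 * (nu + sumN l)) * cos (t * x)))).
    intros l; apply continuous_monomial_cos.
Qed.

Definition edge_density (q L : nat) (h x t : R) : R :=
  exp (- t ^ 2 / 2) * edge_sum q L (t ^ 2) h * cos (t * x).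

Lemma edge_density_sum q L h x t :
  edge_density q L h x t = sumR (map (fun nu => h ^ nu *
    (exp (- t ^ 2 / 2) * edge_poly (edge_coef q) nu (t ^ 2) * cos (t * x))) (seq 0 (S L))).
Proof.
  unfold edge_density, edge_sum.
  rewrite (Rmult_comm (exp _)), Rmult_assoc, Rmult_comm, <- sumR_scal.
  apply sumR_ext; intros nu _. ring.
Qed.

Lemma continuous_edge_density q L h x t : continuous (edge_density q L h x) t.
Proof.
  apply (continuous_ext (fun t => sumR (map (fun nu => h ^ nu *
    (exp (- t ^ 2 / 2) * edge_poly (edge_coef q) nu (t ^ 2) * cos (t * x))) (seq 0 (S L))))).
  - intros s; symmetry; apply edge_density_sum.
  - apply (continuous_sumR (fun nu t => h ^ nu *
      (exp (- t ^ 2 / 2) * edge_poly (edge_coef q) nu (t ^ 2) * cos (t * x)))).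
    intros nu. apply (continuous_scal_r (h ^ nu)
      (fun t => exp (- t ^ 2 / 2) * edge_poly (edge_coef q) nu (t ^ 2) * cos (t * x))).
    apply continuous_edge_poly.
Qed.

Lemma lim_edge_density q L h x :
  (1 <= q)%nat ->
  is_lim_seq (fun i => RInt (edge_density q L h x) (- INR i) (INR i))
    (2 * PI * sumR (map (fun nu => qcoef q nu x * h ^ nu) (seq 0 (S L)))).
Proof.
  intros Hq.
  apply (is_lim_seq_ext (fun i => sumR (map (fun nu => h ^ nu *
      RInt (fun t => exp (- t ^ 2 / 2) * edge_poly (edge_coef q) nu (t ^ 2) * cos (t * x))
        (- INR i) (INR i)) (seq 0 (S L))))).
  { intros i. rewrite (RInt_ext _ _ _ _ (fun t _ => edge_density_sum q L h x t)).
    rewrite (RInt_sumR (fun nu t => h ^ nu *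
      (exp (- t ^ 2 / 2) * edge_poly (edge_coef q) nu (t ^ 2) * cos (t * x)))).
    - apply sumR_ext; intros nu _. symmetry.
      apply (RInt_scal (V := R_CompleteNormedModule)
        (fun t => exp (- t ^ 2 / 2) * edge_poly (edge_coef q) nu (t ^ 2) * cos (t * x))).
      apply ex_RInt_cont, continuous_edge_poly.
    - intros nu t. apply (continuous_scal_r (h ^ nu)
        (fun t => exp (- t ^ 2 / 2) * edge_poly (edge_coef q) nu (t ^ 2) * cos (t * x))).
      apply continuous_edge_poly. }
  rewrite <- sumR_scal.
  apply (is_lim_seq_sumR (fun nu i => h ^ nu *
      RInt (fun t => exp (- t ^ 2 / 2) * edge_poly (edge_coef q) nu (t ^ 2) * cos (t * x))
        (- INR i) (INR i))).
  intros nu _. replace (2 * PI * (qcoef q nu x * h ^ nu)) with (h ^ nu * (2 * PI * qcoef q nu x)) by ring.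
  apply (is_lim_seq_scal_l _ (h ^ nu) (2 * PI * qcoef q nu x)), lim_edge_poly, Hq.
Qed.

(** * Integral error estimates and the uniform expansion *)

Lemma RInt_atan_bound (F : R -> R) (c a b : R) :
  a <= b -> (forall t, continuous F t) ->
  (forall t, a <= t <= b -> Rabs (F t) <= c / (1 + t ^ 2)) ->
  Rabs (RInt F a b) <= c * (atan b - atan a).
Proof.
  intros Hab HF HB.
  (* The majorant has primitive [c atan t], so the bound stays finite over the whole line. *)
  assert (I : is_RInt (fun t => c / (1 + t ^ 2)) a b (c * (atan b - atan a))).
  { apply (is_RInt_ext (fun t => scal c (/ (1 + t ^ 2)))); [reflexivity|].
    apply (is_RInt_scal (V := R_NormedModule)).
    apply (is_RInt_derive (V := R_CompleteNormedModule) atan).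
    - intros s _. assert (P := one_plus_sqr_pos s). auto_derive; auto. unfold Rsqr; field. lra.
    - intros s _. apply (ex_derive_continuous (V := R_NormedModule)).
      assert (P := one_plus_sqr_pos s). auto_derive. lra. }
  rewrite <- (is_RInt_unique _ _ _ _ I).
  eapply Rle_trans; [apply abs_RInt_le; [exact Hab|apply ex_RInt_cont, HF]|].
  apply RInt_le; auto.
  - apply ex_RInt_cont. intros t. apply (continuous_comp F Rabs); auto.
    apply (continuous_abs (K := R_AbsRing)).
  - eexists; exact I.
  - intros t Ht. apply HB; lra.
Qed.

Lemma continuous_rescaled_density q n u x t :
  continuous (fun t => (dirichlet q (t / u) / (1 + INR q)) ^ n * cos (t * x)) t.
Proof.
  apply (continuous_mult (fun t => (dirichlet q (t / u) / (1 + INR q)) ^ n)).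
  - apply continuous_pow_fun.
    apply (continuous_scal_l (fun t => dirichlet q (t / u)) (/ (1 + INR q))).
    apply (continuous_comp (fun t => t / u) (dirichlet q)); [|apply continuous_dirichlet].
    apply (ex_derive_continuous (V := R_NormedModule)). auto_derive; auto.
  - solve_continuous.
Qed.

(** After rescaling, [[-pi, pi]] becomes [[-T, T]] with [T = pi u]. There the two integrands are
    compared pointwise; on the tails only [edge_density] remains, controlled by [gauss_far]. The
    arctangents telescope to at most [pi] for every [i], and [2 pi] is kept to match the Fourier
    factor. *)
Lemma integral_comparison q L :
  (1 <= q)%nat ->
  exists C, 0 <= C /\ forall n x i, (1 <= n)%nat -> PI * sqrt (variance q * INR n) <= INR i ->
    Rabs (RInt (fun t => (dirichlet q (t / sqrt (variance q * INR n)) / (1 + INR q)) ^ n * cos (t * x))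
            (- (PI * sqrt (variance q * INR n))) (PI * sqrt (variance q * INR n))
          - RInt (edge_density q L (/ INR n) x) (- INR i) (INR i))
    <= 2 * PI * (C * (/ INR n) ^ S L).
Proof.
  intros Hq. assert (Hv := variance_pos q Hq). assert (HP := PI_RGT_0).
  destruct (pointwise q L Hq) as [C1 [HC1 H1]].
  destruct (gauss_far q L (PI ^ 2) Hq) as [C2 [HC2 H2]]; [apply pow_lt; lra|].
  exists (C1 + C2). split; [lra|]. intros n x i Hn Hi.
  specialize (fun t => H1 n t Hn). specialize (fun t => H2 n t Hn).
  assert (Hn0 : 0 < INR n) by (apply lt_0_INR; lia).
  assert (Hvn : 0 < variance q * INR n) by (apply Rmult_lt_0_compat; auto).
  set (u := sqrt (variance q * INR n)) in *. assert (Hu : 0 < u) by (apply sqrt_lt_R0, Hvn).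
  assert (Hu2 : variance q * INR n = u ^ 2) by (unfold u; rewrite pow2_sqrt; lra).
  rewrite Hu2 in H1, H2.
  set (h := / INR n) in *. assert (Hh : 0 < h) by (apply Rinv_0_lt_compat, Hn0).
  assert (HhL : 0 < h ^ S L) by (apply pow_lt, Hh).
  set (T := PI * u) in *. assert (HT : 0 < T) by (apply Rmult_lt_0_compat; auto).
  set (f := fun t => (dirichlet q (t / u) / (1 + INR q)) ^ n * cos (t * x)).
  set (g := edge_density q L h x).
  assert (Resc : forall t, u ^ 2 * (t / u) ^ 2 = t ^ 2) by (intros; field; lra).
  assert (Cb : forall t, Rabs (cos (t * x)) <= 1) by (intros; apply Rabs_le, COS_bound).
  assert (Sgn : forall t, - (t ^ 2 / 2) = - t ^ 2 / 2) by (intros; field).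
  assert (Frac : forall c c' t, 0 <= c <= c' -> c * h ^ S L / (1 + t ^ 2) <= c' * h ^ S L / (1 + t ^ 2)).
  { intros c c' t Hc. apply Rmult_le_compat_r.
    - left; apply Rinv_0_lt_compat, one_plus_sqr_pos.
    - apply Rmult_le_compat_r; lra. }
  assert (Cf : forall t, continuous f t).
  { intros t; apply continuous_rescaled_density. }
  assert (Cg : forall t, continuous g t) by apply continuous_edge_density.
  assert (Bin : forall t, - T <= t <= T -> Rabs (f t - g t) <= (C1 + C2) * h ^ S L / (1 + t ^ 2)).
  { intros t Ht. specialize (H1 (t / u)). rewrite Resc, Sgn in H1.
    unfold f, g, edge_density. rewrite <- Rmult_minus_distr_r, Rabs_mult.
    eapply Rle_trans; [|apply (Frac C1); lra].
    eapply Rle_trans; [|apply H1].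
    - rewrite <- (Rmult_1_r (Rabs _)) at 2. apply Rmult_le_compat_l; [apply Rabs_pos|apply Cb].
    - unfold Rdiv. rewrite Rabs_mult, Rabs_inv, (Rabs_right u) by lra.
      apply Rmult_le_reg_r with u; [lra|]. rewrite Rmult_assoc, Rinv_l, Rmult_1_r by lra.
      apply Rabs_le. exact Ht. }
  assert (Bout : forall t, T <= Rabs t -> Rabs (g t) <= (C1 + C2) * h ^ S L / (1 + t ^ 2)).
  { intros t Ht. specialize (H2 (t / u)). rewrite Resc, Sgn in H2.
    unfold g, edge_density. rewrite Rabs_mult.
    eapply Rle_trans; [|apply (Frac C2); lra].
    eapply Rle_trans; [|apply H2].
    - rewrite <- (Rmult_1_r (Rabs _)) at 2. apply Rmult_le_compat_l; [apply Rabs_pos|apply Cb].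
    - rewrite <- (pow2_abs (t / u)). apply pow_incr. split; [lra|].
      unfold Rdiv. rewrite Rabs_mult, Rabs_inv, (Rabs_right u) by lra.
      apply Rmult_le_reg_r with u; [lra|]. rewrite Rmult_assoc, Rinv_l, Rmult_1_r by lra.
      exact Ht. }
  assert (Exf : forall a b, ex_RInt f a b) by (intros; apply ex_RInt_cont, Cf).
  assert (Exg : forall a b, ex_RInt g a b) by (intros; apply ex_RInt_cont, Cg).
  set (I := INR i) in *.
  set (c := (C1 + C2) * h ^ S L) in *.
  assert (Hc : 0 <= c) by (unfold c; apply Rmult_le_pos; lra).
  assert (A1 : Rabs (RInt (fun t => f t - g t) (- T) T) <= c * (atan T - atan (- T))).
  { apply RInt_atan_bound; auto; [lra|]. intros t; apply (continuous_minus f g); auto. }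
  assert (A2 : Rabs (RInt g (- I) (- T)) <= c * (atan (- T) - atan (- I))).
  { apply RInt_atan_bound; auto; [lra|]. intros t Ht. apply Bout. rewrite Rabs_left; lra. }
  assert (A3 : Rabs (RInt g T I) <= c * (atan I - atan T)).
  { apply RInt_atan_bound; auto. intros t Ht. apply Bout. rewrite Rabs_right; lra. }
  assert (Split : RInt g (- I) I = RInt g (- I) (- T) + RInt g (- T) T + RInt g T I).
  { rewrite <- (RInt_Chasles (V := R_CompleteNormedModule) g (- I) T I) by auto.
    rewrite <- (RInt_Chasles (V := R_CompleteNormedModule) g (- I) (- T) T) by auto.
    reflexivity. }
  assert (Dm : RInt (fun t => f t - g t) (- T) T = RInt f (- T) T - RInt g (- T) T)
    by (apply (RInt_minus (V := R_CompleteNormedModule) f g); auto).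
  replace (RInt f (- T) T - RInt g (- I) I) with
    (RInt (fun t => f t - g t) (- T) T + - RInt g (- I) (- T) + - RInt g T I)
    by (rewrite Split, Dm; ring).
  assert (At := atan_bound I). assert (At' := atan_bound (- I)).
  apply Rle_trans with (c * (atan I - atan (- I))).
  - eapply Rle_trans; [apply Rabs_triang|]. eapply Rle_trans;
      [apply Rplus_le_compat_r, Rabs_triang|]. rewrite !Rabs_Ropp. lra.
  - rewrite Rmult_comm. apply Rmult_le_compat_r; lra.
Qed.

Lemma local_limit_expansion q L :
  (1 <= q)%nat ->
  exists C, 0 <= C /\ forall n k, (1 <= n)%nat ->
    let u := sqrt (variance q * INR n) in
    let x := (IZR k - INR q / 2 * INR n) / u in
    Rabs (u / (1 + INR q) ^ n * INR (ext_binom q n k) -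
          sumR (map (fun nu => qcoef q nu x * (/ INR n) ^ nu) (seq 0 (S L))))
    <= C * (/ INR n) ^ S L.
Proof.
  intros Hq. assert (Hv := variance_pos q Hq). assert (HP := PI_RGT_0). assert (Hq0 := pos_INR q).
  destruct (integral_comparison q L Hq) as [C [HC H]].
  exists C; split; [exact HC|]. intros n k Hn u x. specialize (fun i => H n x i Hn).
  assert (Hn0 : 0 < INR n) by (apply lt_0_INR; lia).
  fold u in H. assert (Hu : 0 < u) by (apply sqrt_lt_R0, Rmult_lt_0_compat; auto).
  set (f := fun t => (dirichlet q (t / u) / (1 + INR q)) ^ n * cos (t * x)) in *.
  assert (Hpow : 0 < (1 + INR q) ^ n) by (apply pow_lt; lra).
  assert (F : RInt f (- (PI * u)) (PI * u) =
     2 * PI * (u / (1 + INR q) ^ n * INR (ext_binom q n k))).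
  { replace (2 * PI * (u / (1 + INR q) ^ n * INR (ext_binom q n k))) with
      (u / (1 + INR q) ^ n * (2 * PI * INR (ext_binom q n k))) by ring.
    rewrite ext_binom_fourier.
    rewrite <- (RInt_scal (V := R_CompleteNormedModule) _ _ _ (u / (1 + INR q) ^ n))
      by (apply ex_RInt_cont; intros; apply continuous_dirichlet_pow_cos).
    assert (Lc := RInt_comp_lin (V := R_CompleteNormedModule) f u 0 (- PI) PI).
    replace (u * - PI + 0) with (- (PI * u)) in Lc by ring.
    replace (u * PI + 0) with (PI * u) in Lc by ring.
    rewrite <- Lc.
    - apply RInt_ext. intros t _. unfold scal; simpl; unfold mult; simpl. unfold f.
      replace ((u * t + 0) / u) with t by (field; lra).
      replace ((u * t + 0) * x) with ((IZR k - INR q / 2 * INR n) * t) by (unfold x; field; lra).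
      unfold Rdiv at 1. rewrite Rpow_mult_distr, pow_inv. unfold Rdiv. ring.
    - apply ex_RInt_cont. intros t; apply continuous_rescaled_density. }
  rewrite F in H.
  set (S0 := sumR (map (fun nu => qcoef q nu x * (/ INR n) ^ nu) (seq 0 (S L)))).
  set (b := u / (1 + INR q) ^ n * INR (ext_binom q n k)) in *.
  assert (Lim := lim_edge_density q L (/ INR n) x Hq). fold S0 in Lim.
  (* The bound holds for all large [i] and does not depend on [i], so it passes to the limit. *)
  assert (Le : Rbar_le (Rabs (2 * PI * b - 2 * PI * S0)) (2 * PI * (C * (/ INR n) ^ S L))).
  { apply (is_lim_seq_le_loc (fun i => Rabs (2 * PI * b -
        RInt (edge_density q L (/ INR n) x) (- INR i) (INR i)))
        (fun _ => 2 * PI * (C * (/ INR n) ^ S L))).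
    - destruct (INR_unbounded (PI * u)) as [i0 Hi0]. exists i0. intros i Hi. apply H.
      apply le_INR in Hi. lra.
    - apply (is_lim_seq_abs _ (2 * PI * b - 2 * PI * S0)).
      apply is_lim_seq_minus'; [apply is_lim_seq_const|exact Lim].
    - apply is_lim_seq_const. }
  simpl in Le. rewrite <- Rmult_minus_distr_l, Rabs_mult, (Rabs_right (2 * PI)) in Le by lra.
  apply Rmult_le_reg_l with (2 * PI); [lra|exact Le].
Qed.

(** The only tuple is the empty one and [H_0 = 1], so index 0 supplies the leading Gaussian term. *)
Lemma qcoef_0 q x : qcoef q 0 x = / sqrt (2 * PI) * exp (- x ^ 2 / 2).
Proof.
  unfold qcoef, compositions, sumR, prodR, sumN; simpl.
  unfold hermite; simpl Derive_n. simpl pow.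
  set (w := x * (x * 1)).
  assert (E : exp (w / 2) * exp (- w / 2) = 1).
  { rewrite <- exp_plus. replace (w / 2 + - w / 2) with 0 by field. apply exp_0. }
  transitivity (/ sqrt (2 * PI) * exp (- w / 2) * (exp (w / 2) * exp (- w / 2))); [ring|].
  rewrite E; ring.
Qed.

Theorem theorem1 (q N : nat) (hq : (1 <= q)%nat) (hN : (2 <= N)%nat) :
  forall eps : R, 0 < eps ->
  exists n0 : nat, forall (n : nat) (k : Z), (n0 <= n)%nat ->
    let x := sqrt 12 / sqrt (INR q * (INR q + 2) * INR n)
             * (IZR k - INR q / 2 * INR n) in
    Rabs (sqrt (INR q * (INR q + 2) * INR n / 12) / (1 + INR q) ^ n
            * INR (ext_binom q n k)
          - (/ sqrt (2 * PI) * exp (- x ^ 2 / 2)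
             + sumR (map (fun nu => qcoef q nu x / INR n ^ nu)
                         (seq 1 ((N - 2) / 2)))))
    <= eps / sqrt (INR n) ^ (N - 2).
Proof.
  intros eps Heps. set (L := ((N - 2) / 2)%nat).
  (* Rounding down loses at most one, so [n^(-(L+1))] is below [n^(-(N-2)/2)] by a factor of at
     least [n^(1/2)]. *)
  assert (HL : (N - 2 <= 2 * L + 1)%nat).
  { assert (E := Nat.div_mod_eq (N - 2) 2). assert (M := Nat.mod_upper_bound (N - 2) 2). fold L in E. lia. }
  destruct (local_limit_expansion q L hq) as [C [HC H]].
  assert (HQ : 0 < INR q * (INR q + 2)) by (assert (V := variance_pos q hq); unfold variance in V; lra).
  (* For [n] beyond this threshold [C <= eps sqrt n], so the spare root absorbs the constant; the
     successor taken next also ensures [n >= 1]. *)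
  destruct (INR_unbounded ((C / eps) ^ 2)) as [n1 Hn1].
  exists (S n1). intros n k Hn x.
  assert (Hn1' : INR n1 <= INR n) by (apply le_INR; lia).
  assert (Hn0 : 1 <= INR n) by (apply (le_INR 1); lia).
  specialize (H n k ltac:(lia)). cbv zeta in H.
  replace (variance q * INR n) with (INR q * (INR q + 2) * INR n / 12) in H by (unfold variance; field).
  set (u := sqrt (INR q * (INR q + 2) * INR n / 12)) in *.
  replace ((IZR k - INR q / 2 * INR n) / u) with x in H.
  2: { unfold x, u. assert (0 < sqrt 12) by (apply sqrt_lt_R0; lra).
       assert (0 < INR q * (INR q + 2) * INR n) by (apply Rmult_lt_0_compat; lra).
       assert (0 < sqrt (INR q * (INR q + 2) * INR n)) by (apply sqrt_lt_R0; lra).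
       rewrite sqrt_div by lra. field. lra. }
  change (seq 0 (S L)) with (0%nat :: seq 1 L) in H. cbn [map] in H.
  change (sumR (?a :: ?r)) with (a + sumR r) in H.
  rewrite qcoef_0, pow_O, Rmult_1_r in H.
  rewrite (sumR_ext (fun nu => qcoef q nu x / INR n ^ nu) (fun nu => qcoef q nu x * (/ INR n) ^ nu))
    by (intros; unfold Rdiv; rewrite pow_inv; reflexivity).
  eapply Rle_trans; [exact H|].
  set (r := sqrt (INR n)).
  assert (Hr2 : r * r = INR n) by (apply sqrt_sqrt; lra).
  assert (Hr : 1 <= r) by (unfold r; rewrite <- sqrt_1; apply sqrt_le_1_alt, Hn0).
  assert (HCr : C <= eps * r).
  { assert (C / eps <= r).
    { apply Rsqr_incr_0_var; [rewrite Rsqr_pow2; unfold Rsqr; lra|lra]. }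
    replace C with (C / eps * eps) by (field; lra). rewrite Rmult_comm.
    apply Rmult_le_compat_l; lra. }
  assert (Hp : r * r ^ (N - 2) <= INR n ^ S L).
  { rewrite <- Hr2. replace (r * r) with (r ^ 2) by ring. rewrite <- pow_mult, tech_pow_Rmult.
    apply Rle_pow; [lra|lia]. }
  assert (Hrp : 0 < r ^ (N - 2)) by (apply pow_lt; lra).
  assert (Hnp : 0 < INR n ^ S L) by (apply pow_lt; lra).
  rewrite pow_inv. apply Rmult_le_reg_r with (INR n ^ S L * r ^ (N - 2));
    [apply Rmult_lt_0_compat; lra|].
  replace (C * / INR n ^ S L * (INR n ^ S L * r ^ (N - 2))) with (C * r ^ (N - 2)) by (field; lra).
  replace (eps / r ^ (N - 2) * (INR n ^ S L * r ^ (N - 2))) with (eps * INR n ^ S L) by (field; lra).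
  apply Rle_trans with (eps * r * r ^ (N - 2)).
  - apply Rmult_le_compat_r; lra.
  - rewrite Rmult_assoc. apply Rmult_le_compat_l; lra.
Qed.
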